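(* Let $G$ and $H$ be graphs such that the Cartesian product $G\times H$ is simply polytopal. Then the simple polytope whose graph is $G\times H$ is unique up to combinatorial equivalence. Consequently, products of simple polytopes are the only simple polytopes whose graph is a product: if $P$ is a simple polytope whose graph is isomorphic to $G\times H$, then $P$ is combinatorially equivalent to a product $Q\times R$, where $Q$ and $R$ are simple polytopes whose graphs are isomorphic to $G$ and $H$ respectively.
   Context: Graphs are finite, simple and nonempty. A polytope is the convex hull of finitely many points in some $\mathbb{R}^N$; a $d$-polytope is a polytope of dimension $d$. The graph of a polytope is the abstract graph formed by its vertices and edges. A $d$-polytope is simple if all its vertex figures are simplices, equivalently if each vertex is contained in exactly $d$ edges (so a point is a simple $0$-polytope). A graph is simply polytopal if it is isomorphic to the graph of some simple polytope. Two polytopes are combinatorially equivalent if their face lattices are isomorphic. The Cartesian product $G\times H$ has vertex set $V(G)\times V(H)$, and $(a,b)$, $(c,e)$ are adjacent if and only if either $a=c$ and $\{b,e\}\in E(H)$, or $b=e$ and $\{a,c\}\in E(G)$. The product of polytopes $Q\subset\mathbb{R}^m$ and $R\subset\mathbb{R}^n$ is $Q\times R\subset\mathbb{R}^{m+n}$. *)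

(* Defs.v *)
From mathcomp Require Import all_boot all_order all_algebra.
From mathcomp Require Import boolp classical_sets functions reals.

Set Implicit Arguments.
Unset Strict Implicit.
Unset Printing Implicit Defensive.

Import Order.TTheory GRing.Theory Num.Theory.

Local Open Scope classical_set_scope.
Local Open Scope ring_scope.

Record sgraph := SGraph {
  vert :> finType;
  adj : rel vert;
  adj_sym : symmetric adj;
  adj_irr : irreflexive adj;
  vert_gt0 : (0 < #|vert|)%N
}.

Definition cart_adj (G H : sgraph) : rel (G * H) := fun p q =>
  (p.1 == q.1) && adj p.2 q.2 || (p.2 == q.2) && adj p.1 q.1.

Lemma cart_adj_sym (G H : sgraph) : symmetric (@cart_adj G H).
Proof.
move=> p q; rewrite /cart_adj (eq_sym p.1) (eq_sym p.2).
by rewrite (adj_sym p.1) (adj_sym p.2).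
Qed.

Lemma cart_adj_irr (G H : sgraph) : irreflexive (@cart_adj G H).
Proof. by move=> p; rewrite /cart_adj !adj_irr !andbF. Qed.

Lemma cart_gt0 (G H : sgraph) : (0 < #|{: G * H}|)%N.
Proof. by rewrite card_prod muln_gt0 !vert_gt0. Qed.

Definition cart (G H : sgraph) : sgraph :=
  SGraph (@cart_adj_sym G H) (@cart_adj_irr G H) (cart_gt0 G H).

Section Polytopes.
Context {R : realType}.

Definition conv_hull n k (x : 'I_k -> 'rV[R]_n) : set 'rV[R]_n :=
  [set p | exists a : 'I_k -> R,
     [/\ forall i, 0 <= a i, \sum_i a i = 1 & p = \sum_i a i *: x i]].

Definition aff_indep n k (x : 'I_k -> 'rV[R]_n) : Prop :=
  forall a : 'I_k -> R,
    \sum_i a i = 0 -> \sum_i a i *: x i = 0 -> forall i, a i = 0.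

(* [k = 0] is allowed: the empty set is a polytope, of dimension -1. *)
Definition polytope n (P : set 'rV[R]_n) : Prop :=
  exists k (x : 'I_k -> 'rV[R]_n), P = conv_hull x.

(* [k = 0] gives the empty, (-1)-dimensional simplex. *)
Definition simplex n (S : set 'rV[R]_n) : Prop :=
  exists k (x : 'I_k -> 'rV[R]_n), aff_indep x /\ S = conv_hull x.

Definition has_dim n (S : set 'rV[R]_n) (d : nat) : Prop :=
  (exists x : 'I_d.+1 -> 'rV[R]_n, (forall i, S (x i)) /\ aff_indep x) /\
  ~ (exists x : 'I_d.+2 -> 'rV[R]_n, (forall i, S (x i)) /\ aff_indep x).

Definition lin n (c : 'cV[R]_n) (x : 'rV[R]_n) : R := (x *m c) 0 0.

(* [c = 0] is allowed, so that [P] itself and the empty set are faces. *)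
Definition face n (P F : set 'rV[R]_n) : Prop :=
  exists (c : 'cV[R]_n) (b : R),
    (forall x, P x -> lin c x <= b) /\ F = P `&` [set x | lin c x = b].

Definition vertex n (P : set 'rV[R]_n) (v : 'rV[R]_n) : Prop :=
  face P [set v].

Definition edge n (P F : set 'rV[R]_n) : Prop := face P F /\ has_dim F 1.

(* A vertex figure is the section of [P] by a hyperplane separating one vertex
   from all the others.  The inequalities force [c <> 0] unless [v] is the only
   vertex; in that case the section is empty in any event. *)
Definition vertex_figure n (P : set 'rV[R]_n) (v : 'rV[R]_n)
    (S : set 'rV[R]_n) : Prop :=
  exists (c : 'cV[R]_n) (b : R),
    [/\ lin c v < b,
        forall w, vertex P w -> w <> v -> b < lin c w
      & S = P `&` [set x | lin c x = b]].

Definition simple_polytope n (P : set 'rV[R]_n) : Prop :=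
  polytope P /\
  forall v S, vertex P v -> vertex_figure P v S -> simplex S.

Definition polytope_adj n (P : set 'rV[R]_n) (u v : 'rV[R]_n) : Prop :=
  [/\ vertex P u, vertex P v, u <> v & exists F, [/\ edge P F, F u & F v]].

(* [f] is an isomorphism from [G] onto the graph of [P]. *)
Definition has_graph n (P : set 'rV[R]_n) (G : sgraph) : Prop :=
  exists f : G -> 'rV[R]_n,
    set_bij [set: G] (vertex P) f /\
    forall u v, adj u v <-> polytope_adj P (f u) (f v).

(* An inclusion-preserving and -reflecting bijection between the face posets
   is the same as an isomorphism of the face lattices. *)
Definition comb_equiv m n (P : set 'rV[R]_m) (Q : set 'rV[R]_n) : Prop :=
  exists phi : set 'rV[R]_m -> set 'rV[R]_n,
    set_bij (face P) (face Q) phi /\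
    forall F F', face P F -> face P F' -> (F `<=` F' <-> phi F `<=` phi F').

Definition polytope_prod m n (Q : set 'rV[R]_m) (S : set 'rV[R]_n) :
    set 'rV[R]_(m + n) :=
  [set row_mx x y | x in Q & y in S].

End Polytopes.

Definition simply_polytopal (R : realType) (G : sgraph) : Prop :=
  exists n (P : set 'rV[R]_n), simple_polytope P /\ has_graph P G.

(* Main.v *)
Require Import Defs.
From mathcomp Require Import all_boot all_order all_algebra.
From mathcomp Require Import boolp classical_sets functions reals.
From mathcomp Require Import ring lra.

Set Implicit Arguments.
Unset Strict Implicit.
Unset Printing Implicit Defensive.

Import Order.TTheory GRing.Theory Num.Theory.

Local Open Scope ring_scope.

(** A simple polytope is determined by its graph (Blind and Mani), and the
    proof is Kalai's.  The faces through a vertex [v] of a simple polytope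
    correspond to the sets of neighbours of [v].  Orient the graph along an
    injective height function on the vertices.  Every nonempty face has a sink,
    and a vertex of in-degree k is a sink of exactly 2 ^ k faces, so the sum of
    2 ^ indegree over the vertices is at least the number of nonempty faces,
    with equality iff every nonempty face has only one sink.  Generic linear
    functionals reach equality, so these good heights are the minimizers of a
    quantity that depends on the graph alone.  A face is then recognized in the
    graph as a connected regular set of vertices that comes first for some good
    height.  This is [face_system_unique]; it only uses the few properties
    collected in [face_system].

    For a product graph, the key fact is [common_nbr_in_face]: a face that
    contains two distinct nonadjacent vertices contains all their common
    neighbours.  Applied to the squares formed by an edge of [G] and an edge of
    [H], it shows that the fibers over the two factors are faces
    ([fiber_face]), that every face is a product of vertex sets, and that a
    product is a face iff both of its slices in two fixed fibers are
    ([product_faceP]).  The fibers, as faces of the given polytope, are simple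
    polytopes with graphs [G] and [H], and the nonempty faces of their product
    are the products of their nonempty faces ([vfaces_prod]); so the product
    has the same vertex sets of faces as the given polytope.

    The geometry that links the two levels rests on Farkas' lemma.  It shows
    that a polytope is the hull of its vertices ([polytope_spans]), after which
    faces, edges and combinatorial equivalence are read off the vertex sets
    [vfaces f] of a configuration [f] of points.  A simplex as vertex figure
    means that, seen from the vertex, the polytope lies in the cone over its
    edge directions and that these are linearly independent
    ([simple_at_vnbrs]).  Coordinates in this cone give all the properties of a
    [face_system] ([vfaces_system]); conversely such cones make a polytope
    simple ([simple_of_simple_at]), and they restrict to faces
    ([simple_at_restrict]). *)

(** * Face systems are determined by the graph *)

Section FaceSystems.
Import mathcomp.boot.fintype mathcomp.boot.finset.
Context (R : realDomainType) (V : finType) (e : rel V).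
Implicit Types (FF : {set {set V}}) (A B F T : {set V}) (phi : V -> R).

Definition nbrs v : {set V} := [set w | e v w].

(** For the orientation of the graph along increasing [phi]. *)
Definition sink phi F v :=
  (v \in F) && [forall (w | w \in F), e v w ==> (phi w < phi v)].

(** Kalai's good acyclic orientations, given by a height function: a sink of a
    face is its highest vertex, hence unique. *)
Definition good FF phi :=
  injective phi /\
  forall F v w, F \in FF -> sink phi F v -> w \in F -> phi w <= phi v.

(** What Kalai's argument needs to know about the vertex sets of the faces of a
    simple polytope.  The fields [fs_span] and [fs_sub] say that the faces
    through [v] form the Boolean lattice of the sets of neighbours of [v];
    heights come from linear functionals, for which a face can be made to come
    first. *)
Record face_system FF : Prop := FaceSystem {
  fs_full : [set: V] \in FF;
  fs_cap : forall A B, A \in FF -> B \in FF -> A :&: B \in FF;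
  fs_span : forall v T, T \subset nbrs v ->
    exists F, [/\ F \in FF, v \in F & F :&: nbrs v = T];
  fs_sub : forall v F F', F \in FF -> F' \in FF -> v \in F -> v \in F' ->
    F :&: nbrs v \subset F' -> F \subset F';
  fs_good : forall F, F \in FF ->
    exists phi, good FF phi /\ forall u w, u \in F -> w \notin F -> phi u < phi w
}.

(** Connectedness of the induced subgraph, in the form in which it is used: to
    show that a property spreads to the whole of [A]. *)
Definition connected A := forall B, B != set0 -> B \subset A ->
  (forall x y, x \in B -> y \in A -> e x y -> y \in B) -> B = A.

(** Kalai's function: it involves the graph and the height, but no faces. *)
Definition indeg_weight phi : nat :=
  \sum_v 2 ^ #|[set w in nbrs v | (phi w < phi v)%R]|.

Hypothesis e_sym : symmetric e.
Hypothesis e_irr : irreflexive e.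

Lemma exists_sink phi F : injective phi -> F != set0 ->
  exists2 v, sink phi F v & forall w, w \in F -> phi w <= phi v.
Proof.
move=> phi_inj /set0Pn[v0 v0F].
case: (@arg_maxP _ _ _ v0 (mem F) phi v0F) => v vF vmax0.
have vmax w : w \in F -> phi w <= phi v by exact: vmax0.
exists v => //; rewrite /sink [_ \in F]vF /=; apply/forall_inP => w wF.
apply/implyP => evw; rewrite lt_neqAle vmax // andbT.
by apply: contraTneq evw => /phi_inj ->; rewrite e_irr.
Qed.

Section OneSystem.
Context (FF : {set {set V}}).
Hypothesis FS : face_system FF.

(** The highest vertex of a subset closed in [F] under adjacency is a sink of
    [F], hence the highest vertex of [F].  Two complementary closed subsets
    cannot both contain that vertex. *)
Lemma face_connected F : F \in FF -> connected F.
Proof.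
move=> FFF B B0 BF Bcl.
have [phi [[phi_inj phi_good] _]] := fs_good FS FFF.
have F0 : F != set0.
  by apply: contraNneq B0 => F0; move: BF; rewrite F0 subset0.
have [m /andP[mF _] mmax] := exists_sink phi_inj F0.
have key C : C != set0 -> C \subset F ->
    (forall x y, x \in C -> y \in F -> e x y -> y \in C) -> m \in C.
  move=> C0 CF Ccl; have [v vs vmax] := exists_sink phi_inj C0.
  have vC : v \in C by case/andP: vs.
  have vsF : sink phi F v.
    rewrite /sink (subsetP CF) //=; apply/forall_inP => w wF; apply/implyP => evw.
    have wC := Ccl _ _ vC wF evw.
    by have /andP[_ /forall_inP/(_ w wC)] := vs; rewrite evw.
  suff -> : m = v by [].
  apply: phi_inj; apply/le_anti; rewrite mmax ?(subsetP CF) // andbT.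
  exact: phi_good FFF vsF mF.
have mB := key _ B0 BF Bcl.
apply/eqP; rewrite eqEsubset BF /= -setD_eq0; apply: contraT => D0.
suff: m \in F :\: B by rewrite inE mB.
apply: key => //; first exact: subsetDl.
move=> x y; rewrite !inE => /andP[xB xF] yF exy; rewrite yF andbT.
by apply: contra xB => yB; apply: Bcl yB xF _; rewrite e_sym.
Qed.

(** The map sending a face through [v] to the set of neighbours of [v] on it is
    a bijection onto all sets of neighbours; intervals correspond. *)
Lemma card_faces_at v T T' : T \subset T' -> T' \subset nbrs v ->
  #|[set F in FF | [&& v \in F, T \subset F & F :&: nbrs v \subset T']]| =
  (2 ^ #|T' :\: T|)%N.
Proof.
move=> TT' T'N; rewrite -card_powerset.
set S := finset _.
have <- : (fun F => (F :&: nbrs v) :\: T) @: S = powerset (T' :\: T).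
  apply/setP => U; rewrite powersetE; apply/imsetP/idP => [[F]|UT].
    by rewrite inE => /and4P[_ _ _ FT'] ->; apply: setSD.
  have TUN : T :|: U \subset nbrs v.
    rewrite subUset (subset_trans TT') //=.
    exact: subset_trans UT (subset_trans (subsetDl _ _) T'N).
  have [F [FFF vF Fv]] := fs_span FS TUN.
  exists F; rewrite ?inE ?FFF ?vF ?Fv /=.
    apply/andP; split.
      by apply: subset_trans (subsetIl F (nbrs v)); rewrite Fv subsetUl.
    by rewrite subUset TT' (subset_trans UT (subsetDl _ _)).
  apply/setP => w; rewrite !inE; have := subsetP UT w; rewrite !inE.
  by case: (w \in T) => //=; case: (w \in U) => // /(_ isT).
rewrite card_in_imset // => F F'; rewrite !inE.
move=> /and4P[FFF vF TF _] /and4P[FFF' vF' TF' _] /setP eqF.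
have eqN : F :&: nbrs v = F' :&: nbrs v.
  apply/setP => w; have := eqF w; rewrite !inE.
  have [wT _|//] := boolP (w \in T).
  by rewrite (subsetP TF _ wT) (subsetP TF' _ wT).
apply/eqP; rewrite eqEsubset; apply/andP; split; apply: (@fs_sub _ FS v) => //.
  by rewrite eqN subsetIl.
by rewrite -eqN subsetIl.
Qed.

(** For an edge [u v] of [F], the faces between this edge and [F] can be counted
    from [u] as well as from [v]; this gives the powers of 2 with exponents the
    degree of [u] minus 1 and the degree of [v] minus 1. *)
Lemma face_regular F u v : F \in FF -> u \in F -> v \in F ->
  #|F :&: nbrs u| = #|F :&: nbrs v|.
Proof.
move=> FFF.
have step x y : x \in F -> y \in F -> e x y ->
    #|F :&: nbrs x| = #|F :&: nbrs y|.
  move=> xF yF exy.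
  have count z w : z \in F -> w \in F -> e z w ->
      #|[set F' in FF | [&& z \in F', w \in F' & F' \subset F]]| =
      (2 ^ #|F :&: nbrs z|.-1)%N.
    move=> zF wF ezw.
    have wN : w \in F :&: nbrs z by rewrite !inE wF.
    have := @card_faces_at z [set w] (F :&: nbrs z).
    rewrite sub1set wN subsetIr => /(_ isT isT).
    rewrite (cardsD1 w (F :&: nbrs z)) wN /= => <-.
    apply: eq_card => F'; rewrite !inE sub1set.
    have [F'F|//] := boolP (F' \in FF); have [zF'|//] := boolP (z \in F').
    have [wF'|//] := boolP (w \in F') => /=.
    apply/idP/idP => [F'sub|]; first exact: setSI.
    move=> sub; apply: (@fs_sub _ FS z) => //.
    exact: subset_trans sub (subsetIl _ _).
  have eyx : e y x by rewrite e_sym.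
  have := count _ _ xF yF exy; rewrite -(eq_card (A := [set F' in FF |
    [&& y \in F', x \in F' & F' \subset F]])) ?(count _ _ yF xF eyx); last first.
    by move=> F'; rewrite !inE; case: (x \in F'); case: (y \in F').
  move=> /eqP; rewrite eqn_exp2l // => /eqP eqc.
  have: (0 < #|F :&: nbrs x|)%N by apply/card_gt0P; exists y; rewrite !inE yF.
  have: (0 < #|F :&: nbrs y|)%N by apply/card_gt0P; exists x; rewrite !inE xF.
  by move: eqc; case: #|_| => // a; case: #|_| => //= b ->.
move=> uF vF; pose B := [set w in F | #|F :&: nbrs u| == #|F :&: nbrs w|].
suff BF : B = F by move: vF; rewrite -{1}BF inE => /andP[_ /eqP].
have := face_connected FFF; rewrite /connected => conn; apply: conn.
- by apply/set0Pn; exists u; rewrite inE uF eqxx.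
- by apply/subsetP => w; rewrite inE => /andP[].
move=> x y; rewrite !inE => /andP[xF /eqP ->] yF exy; rewrite yF.
by rewrite (step x y) ?eqxx.
Qed.

Lemma card_sink_faces phi v : #|[set F in FF | sink phi F v]| =
  (2 ^ #|[set w in nbrs v | (phi w < phi v)%R]|)%N.
Proof.
pose L := [set w in nbrs v | (phi w < phi v)%R]; rewrite -/L; have LN : L \subset nbrs v.
  by apply/subsetP => w; rewrite !inE => /andP[].
rewrite -(setD0 L) -(card_faces_at (sub0set L) LN).
apply: eq_card => F; rewrite !inE sub0set /sink /=; case: (v \in F) => //=.
congr (_ && _); apply/forall_inP/subsetP => [H w|sub w wF].
  by rewrite !inE => /andP[wF evw]; rewrite evw (implyP (H w wF)).
by apply/implyP => evw; have := sub w; rewrite !inE wF evw => /(_ isT).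
Qed.

(** Double counting of the pairs of a face and one of its sinks. *)
Lemma indeg_weightE phi :
  indeg_weight phi = (\sum_(F in FF | F != set0) #|[set v | sink phi F v]|)%N.
Proof.
transitivity (\sum_(F in FF) #|[set v | sink phi F v]|)%N; last first.
  rewrite (bigID (fun F => F == set0)) /= big1 ?add0n // => F /andP[_ /eqP ->].
  by apply/eqP; rewrite cards_eq0; apply/eqP/setP => v; rewrite /sink !inE.
rewrite /indeg_weight.
under eq_bigr => v _ do rewrite -card_sink_faces -sum1_card.
under [RHS]eq_bigr => F _ do rewrite -sum1_card.
rewrite (exchange_big_dep (mem FF)) /=; last by move=> v F _; rewrite inE => /andP[].
by apply: eq_bigr => F FFF; apply: eq_bigl => v; rewrite !inE FFF.
Qed.

Lemma card_sinks phi F : injective phi -> F != set0 ->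
  (1 <= #|[set v | sink phi F v]|)%N.
Proof.
move=> phi_inj F0; have [v vs _] := exists_sink phi_inj F0.
by apply/card_gt0P; exists v; rewrite inE.
Qed.

Lemma leqif_indeg_weight phi : injective phi ->
  (#|FF :\ set0| <= indeg_weight phi ?= iff
   [forall (F | (F \in FF) && (F != set0)), 1 == #|[set v | sink phi F v]|])%N.
Proof.
move=> phi_inj; rewrite indeg_weightE -sum1_card.
under eq_bigl => F do rewrite !inE andbC.
apply: leqif_sum => F /andP[_ F0]; split=> //; exact: card_sinks.
Qed.

Lemma good_indeg_weight phi : injective phi ->
  good FF phi <-> indeg_weight phi = #|FF :\ set0|.
Proof.
move=> phi_inj; have [_ eq_iff] := leqif_indeg_weight phi_inj.
split=> [[_ phi_good]|/esym/eqP].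
  apply/esym/eqP; rewrite eq_iff; apply/forall_inP => F /andP[FFF F0].
  have [v vs vmax] := exists_sink phi_inj F0; rewrite eq_sym.
  apply/cards1P; exists v; apply/setP => w; rewrite !inE.
  apply/idP/eqP => [ws|-> //]; apply: phi_inj; apply/le_anti.
  have [wF _] := andP ws; have [vF _] := andP vs.
  by rewrite vmax // (phi_good _ _ _ FFF ws).
rewrite eq_iff => /forall_inP H; split=> // F v w FFF vs wF.
have F0 : F != set0 by apply/set0Pn; exists w.
have [m ms mmax] := exists_sink phi_inj F0.
have /cards1P[x eqx] : #|[set v | sink phi F v]| == 1%N.
  by rewrite eq_sym H // FFF.
have : v \in [set v | sink phi F v] by rewrite inE.
have : m \in [set v | sink phi F v] by rewrite inE.
by rewrite eqx !inE => /eqP <- /eqP ->; apply: mmax.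
Qed.

End OneSystem.

(** A good height for [FF] attains the number of nonempty members of [FF], and
    the weight of any height bounds that of [FF'] from above. *)
Lemma card_face_system_le FF FF' : face_system FF -> face_system FF' ->
  (#|FF' :\ set0| <= #|FF :\ set0|)%N.
Proof.
move=> FS FS'; have [phi [phi_good _]] := fs_good FS (fs_full FS).
have phi_inj := phi_good.1.
have /(good_indeg_weight FS phi_inj) <- := phi_good.
by case: (leqif_indeg_weight FS' phi_inj).
Qed.

(** Take a height that is good for [FF] and puts [A] first.  By counting, it is
    good for [FF'] too.  The edges of [A] at its highest vertex [v] span a
    member [F] of [FF'], with [v] as sink; so [F] lies below [v], hence in [A].
    Both are regular of the same degree and [A] is connected, so they agree. *)
Lemma face_system_sub FF FF' : face_system FF -> face_system FF' ->
  FF :\ set0 \subset FF'.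
Proof.
move=> FS FS'; apply/subsetP => A; rewrite !inE => /andP[A0 AFF].
have [phi [phi_good A_init]] := fs_good FS AFF.
have phi_inj := phi_good.1.
have phi_good' : good FF' phi.
  apply/(good_indeg_weight FS' phi_inj).
  have /(good_indeg_weight FS phi_inj) -> := phi_good.
  by apply/eqP; rewrite eqn_leq !card_face_system_le.
have [v vs vmax] := exists_sink phi_inj A0; have [vA _] := andP vs.
have [F [FFF' vF Fv]] := fs_span FS' (subsetIr A (nbrs v)).
have vsF : sink phi F v.
  rewrite /sink vF; apply/forall_inP => w wF; apply/implyP => evw.
  have : w \in F :&: nbrs v by rewrite !inE wF.
  rewrite Fv !inE => /andP[wA _].
  by have /andP[_ /forall_inP/(_ w wA)] := vs; rewrite evw.
have FA : F \subset A.
  apply/subsetP => w wF; have := phi_good'.2 _ _ _ FFF' vsF wF.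
  by apply: contraTT => wA; rewrite -ltNge A_init.
suff <- : F = A by [].
have := face_connected FS AFF; rewrite /connected => conn; apply: conn => //.
  by apply/set0Pn; exists v.
move=> x y xF yA exy.
have /eqP eqN : F :&: nbrs x == A :&: nbrs x.
  rewrite eqEcard setSI //= (face_regular FS AFF (subsetP FA _ xF) vA).
  by rewrite (face_regular FS' FFF' xF vF) Fv.
have : y \in A :&: nbrs x by rewrite !inE yA.
by rewrite -eqN !inE => /andP[].
Qed.

End FaceSystems.

Lemma face_system_unique (R : realDomainType) (V : finType) (e : rel V)
    (FF FF' : {set {set V}}) :
  symmetric e -> irreflexive e -> finset.set0 \in FF -> finset.set0 \in FF' ->
  face_system R e FF -> face_system R e FF' -> FF = FF'.
Proof.
move=> e_sym e_irr FF0 FF0' FS FS'.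
apply/eqP; rewrite finset.eqEsubset; apply/andP; split.
  have DK := finset.setD1K FF0; rewrite -{1}DK.
  by rewrite finset.subUset finset.sub1set FF0' (face_system_sub e_sym e_irr FS).
have DK := finset.setD1K FF0'; rewrite -{1}DK.
by rewrite finset.subUset finset.sub1set FF0 (face_system_sub e_sym e_irr FS').
Qed.

(** * Faces in a product graph *)
Section ProductFaces.
Import mathcomp.boot.fintype mathcomp.boot.finset.
Context (R : realDomainType) (V : finType) (e : rel V).
Context (FF : {set {set V}}).
Hypotheses (e_sym : symmetric e) (e_irr : irreflexive e).
Hypothesis FS : face_system R e FF.
Implicit Types (C F : {set V}).

(** Otherwise [F] meets the 2-face [K] spanned by the path [a b c] in a face
    [X] that misses [b].  Since [K] has degree 2, the face [X] has degree at
    most 1: it is a vertex or an edge, and contains [a] and [c]. *)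
Lemma common_nbr_in_face F a b c : F \in FF -> a \in F -> c \in F ->
  e a b -> e b c -> a != c -> ~~ e a c -> b \in F.
Proof.
move=> FFF aF cF eab ebc ac eac; apply: contraT => bF.
have acN : [set a; c] \subset nbrs e b.
  by rewrite subUset !sub1set !inE ebc e_sym eab.
have [K [KFF bK Kb]] := fs_span FS acN.
have /andP[aK _] : (a \in K) && (a \in nbrs e b).
  by rewrite -in_setI Kb !inE eqxx.
have /andP[cK _] : (c \in K) && (c \in nbrs e b).
  by rewrite -in_setI Kb !inE eqxx orbT.
pose X := F :&: K; have XFF : X \in FF by apply: fs_cap FS _ _ _ _.
have aX : a \in X by rewrite inE aF.
have cX : c \in X by rewrite inE cF.
have degX : (#|X :&: nbrs e a| <= 1)%N.
  rewrite -ltnS -[2%N](_ : #|K :&: nbrs e b| = 2%N); last by rewrite Kb cards2 ac.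
  rewrite (face_regular e_sym e_irr FS KFF bK aK).
  apply: proper_card; apply/properP; split; first by rewrite setSI ?subsetIr.
  by exists b; rewrite !inE ?bK ?eab // (negbTE bF).
have eqX : a |: X :&: nbrs e a = X.
  apply: (face_connected e_sym e_irr FS XFF _ _ _).
  - by apply/set0Pn; exists a; rewrite !inE eqxx.
  - by rewrite subUset sub1set aX subsetIl.
  move=> x y; rewrite !in_setU1 => /predU1P[-> yX eay|].
    by rewrite [y \in _ :&: _]inE yX inE eay orbT.
  rewrite inE => /andP[xX]; rewrite inE => eax yX exy.
  suff -> : y = a by rewrite eqxx.
  move: degX; rewrite (face_regular e_sym e_irr FS XFF aX xX) => /card_le1_eqP.
  by apply; rewrite in_setI ?aX ?yX inE ?exy // e_sym.
have : c \in a |: X :&: nbrs e a by rewrite eqX.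
by rewrite !inE eq_sym (negbTE ac) (negbTE eac) andbF.
Qed.

(** Let [F] be the face spanned at [v] by the edges of [C].  An edge [y z] that
    leaves [C] is opposite, in a square, to an edge [x b] that leaves [C]; if
    [z] were in [F], then so would be [b] by [common_nbr_in_face].  So [F] has
    no edge leaving [C] at [y] if it has none at [x], and by regularity it then
    has all the edges of [C] at [y]. *)
Lemma face_of_squares C v : v \in C -> connected e C ->
  (forall x y, x \in C -> y \in C -> #|nbrs e x :\: C| = #|nbrs e y :\: C|) ->
  (forall x y z, x \in C -> y \in C -> z \notin C -> e x y -> e y z ->
    exists b, [/\ b \notin C, e x b, e b z, x != z & ~~ e x z]) ->
  C \in FF.
Proof.
move=> vC Cconn Creg Csq.
have [F [FFF vF Fv]] := fs_span FS (subsetIr C (nbrs e v)).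
have regC x y : x \in C -> y \in C -> #|C :&: nbrs e x| = #|C :&: nbrs e y|.
  move=> xC yC; have := face_regular e_sym e_irr FS (fs_full FS) (in_setT x) (in_setT y).
  rewrite !setTI -(cardsID C (nbrs e x)) -(cardsID C (nbrs e y)) (Creg _ _ xC yC).
  by rewrite ![C :&: _]setIC => /addIn.
pose D := [set x in C | (x \in F) && (F :&: nbrs e x == C :&: nbrs e x)].
have eqD : D = C.
  apply: (Cconn _ _ _).
  - by apply/set0Pn; exists v; rewrite !inE vC vF Fv eqxx.
  - by apply/subsetP => x; rewrite inE => /andP[].
  move=> x y; rewrite [x \in D]inE => /and3P[xC xF /eqP Fx] yC exy.
  have yF : y \in F.
    have : y \in C :&: nbrs e x by rewrite !inE yC.
    by rewrite -Fx !inE => /andP[].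
  rewrite inE yC yF /= eqEcard (regC y x) // -Fx.
  rewrite (face_regular e_sym e_irr FS FFF xF yF) leqnn andbT.
  apply/subsetP => z; rewrite !inE => /andP[zF eyz]; rewrite eyz andbT.
  apply: contraT => zC; have [b [bC exb ebz xz exz]] := Csq _ _ _ xC yC zC exy eyz.
  have bF := common_nbr_in_face FFF xF zF exb ebz xz exz.
  have : b \in F :&: nbrs e x by rewrite !inE bF.
  by rewrite Fx inE (negbTE bC).
have CD x : x \in C -> (x \in F) && (F :&: nbrs e x == C :&: nbrs e x).
  by rewrite -{1}eqD inE => /andP[].
suff -> : C = F by [].
apply: (face_connected e_sym e_irr FS FFF _ _ _).
- by apply/set0Pn; exists v.
- by apply/subsetP => x /CD/andP[].
move=> x y /CD/andP[_ /eqP Fx] yF exy.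
have : y \in F :&: nbrs e x by rewrite !inE yF.
by rewrite Fx inE => /andP[].
Qed.

(** The vertices and edges of a product of graphs, seen through abstract
    projections and pairing so that the two factors can be exchanged. *)
Record is_product (A B : finType) (eA : rel A) (eB : rel B)
    (p1 : V -> A) (p2 : V -> B) (mk : A -> B -> V) : Prop := IsProduct {
  prod_p1K : forall a b, p1 (mk a b) = a;
  prod_p2K : forall a b, p2 (mk a b) = b;
  prod_mkK : forall x, mk (p1 x) (p2 x) = x;
  prod_adjE : forall x y, e x y = (p1 x == p1 y) && eB (p2 x) (p2 y)
                               || (p2 x == p2 y) && eA (p1 x) (p1 y);
  prod_symA : symmetric eA;
  prod_symB : symmetric eB;
  prod_irrA : irreflexive eA;
  prod_irrB : irreflexive eB
}.

Lemma is_product_sym (A B : finType) (eA : rel A) (eB : rel B) p1 p2 mk :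
  is_product eA eB p1 p2 mk -> is_product eB eA p2 p1 (fun b a => mk a b).
Proof. by case=> *; split=> // x y; rewrite orbC. Qed.

Section Product.
Context (A B : finType) (eA : rel A) (eB : rel B).
Context (p1 : V -> A) (p2 : V -> B) (mk : A -> B -> V).
Hypothesis Vprod : is_product eA eB p1 p2 mk.

Lemma product_adj a b a' b' :
  e (mk a b) (mk a' b') = (a == a') && eB b b' || (b == b') && eA a a'.
Proof. by rewrite (prod_adjE Vprod) !(prod_p1K Vprod) !(prod_p2K Vprod). Qed.

(** The vertices that share their [B]-coordinate with [v] form a copy of the
    first factor.  It is connected because the whole graph is: pull a closed
    subset back along the first coordinate. *)
Lemma fiber_face v : [set x | p2 x == p2 v] \in FF.
Proof.
have [p1K p2K mkK _ _ _ irrA irrB] := Vprod; set b := p2 v.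
have inC a b' : (mk a b' \in [set x | p2 x == b]) = (b' == b) by rewrite inE p2K.
apply: (@face_of_squares _ v); first by rewrite inE.
- move=> B' /set0Pn[x0 x0B] /subsetP BC Bcl.
  pose B'' := [set x | mk (p1 x) b \in B'].
  have x0E : mk (p1 x0) b = x0.
    by have := BC _ x0B; rewrite inE => /eqP <-.
  have eqB : B'' = [set: V].
    apply: (face_connected e_sym e_irr FS (fs_full FS) _ _ _).
    - by apply/set0Pn; exists x0; rewrite inE x0E.
    - exact: subsetT.
    move=> x y; rewrite !inE -(mkK x) -(mkK y) product_adj !p1K => xB _.
    case/orP => [/andP[/eqP <- //]|/andP[_ exy]].
    by apply: Bcl xB _ _; rewrite ?inC // product_adj eqxx exy orbT.
  apply/eqP; rewrite eqEsubset; apply/andP; split; first by apply/subsetP.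
  apply/subsetP => x; rewrite inE => /eqP xb.
  by have := in_setT x; rewrite -eqB inE -xb mkK.
- have NC x : x \in [set x | p2 x == b] ->
      nbrs e x :\: [set x | p2 x == b] = mk (p1 x) @: [set b' | eB b b'].
    rewrite -(mkK x) inC p1K => /eqP ->; apply/setP => y; rewrite -(mkK y).
    rewrite !inE p2K product_adj.
    apply/andP/imsetP => [[yb /orP[/andP[/eqP -> eby]|]]|[b']].
    - by exists (p2 y); rewrite ?inE.
    - by rewrite eq_sym (negbTE yb).
    rewrite inE => ebb' /(congr1 (fun z => (p1 z, p2 z))).
    rewrite !p1K !p2K => -[-> ->]; rewrite eqxx ebb'; split=> //.
    by apply: contraTneq ebb' => ->; rewrite irrB.
  move=> x y xC yC; rewrite (NC x xC) (NC y yC) !card_imset //.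
  - by move=> b1 b2 /(congr1 p2); rewrite !p2K.
  - by move=> b1 b2 /(congr1 p2); rewrite !p2K.
move=> x y z; rewrite -(mkK x) -(mkK y) -(mkK z) !inC !product_adj.
move=> /eqP -> /eqP ->; rewrite eqxx irrB andbF /= eq_sym => zb exy.
rewrite (negbTE zb) orbF => /andP[/eqP <- ebz].
exists (mk (p1 x) (p2 z)); rewrite inC eq_sym zb !product_adj !eqxx exy ebz orbT.
rewrite (negbTE zb) /= orbF; split=> //.
  by apply: contraNneq zb => /(congr1 p2); rewrite !p2K => ->.
by apply/negP => /andP[/eqP eqxy _]; rewrite eqxy irrA in exy.
Qed.
End Product.

Section Rectangles.
Context (A B : finType) (eA : rel A) (eB : rel B).
Context (p1 : V -> A) (p2 : V -> B) (mk : A -> B -> V).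
Hypothesis Vprod : is_product eA eB p1 p2 mk.
Implicit Types (a : A) (b : B).

Let fiber1_face v : [set x | p1 x == p1 v] \in FF :=
  fiber_face (is_product_sym Vprod) v.
Let p1K a b : p1 (mk a b) = a. Proof. exact: prod_p1K Vprod _ _. Qed.
Let p2K a b : p2 (mk a b) = b. Proof. exact: prod_p2K Vprod _ _. Qed.
Let mkK x : mk (p1 x) (p2 x) = x. Proof. exact: prod_mkK Vprod x. Qed.
Let irrA : irreflexive eA. Proof. exact: prod_irrA Vprod. Qed.
Let irrB : irreflexive eB. Proof. exact: prod_irrB Vprod. Qed.

Lemma face_corner F a a' b b' : F \in FF -> eA a a' -> eB b b' ->
  mk a b' \in F -> mk a' b \in F -> mk a' b' \in F.
Proof.
move=> FFF eaa' ebb' abF a'bF.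
have aa' : (a == a') = false by apply: contraTF eaa' => /eqP <-; rewrite irrA.
have bb' : (b == b') = false by apply: contraTF ebb' => /eqP ->; rewrite irrB.
apply: (common_nbr_in_face FFF abF a'bF); rewrite ?(product_adj Vprod).
- by rewrite eqxx eaa' orbT.
- by rewrite eqxx (prod_symB Vprod) ebb'.
- by apply: contraFneq aa' => /(congr1 p1); rewrite !p1K => ->.
- by rewrite aa' eq_sym bb'.
Qed.

(** The intersection of [F] with a fiber is a face, hence connected; along it,
    [face_corner] carries a neighbour in [F] from one point to the next. *)
Lemma face_fiber_step F a a' b b' : F \in FF -> eA a a' ->
  mk a b \in F -> mk a' b \in F -> mk a b' \in F -> mk a' b' \in F.
Proof.
move=> FFF eaa' abF a'bF ab'F.
pose X := F :&: [set x | p1 x == p1 (mk a b)].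
have XFF : X \in FF by apply: fs_cap FS _ _ _ _.
pose Y := [set x in X | mk a' (p2 x) \in F].
have inX c c' : (mk c c' \in X) = (mk c c' \in F) && (c == a).
  by rewrite !inE !p1K.
have inY c c' : (mk c c' \in Y) = (mk c c' \in X) && (mk a' c' \in F).
  by rewrite inE p2K.
suff YX : Y = X by move: (inY a b'); rewrite YX inX ab'F eqxx /= => <-.
apply: (face_connected e_sym e_irr FS XFF _ _ _).
- by apply/set0Pn; exists (mk a b); rewrite inY inX abF eqxx.
- by apply/subsetP => x; rewrite inE => /andP[].
move=> x y; rewrite -(mkK x) -(mkK y) !inY !inX (product_adj Vprod).
move=> /andP[/andP[xF /eqP xa] a'xF] /andP[yF /eqP ya].
rewrite yF ya eqxx xa eqxx irrA andbF orbF /= => exy.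
by apply: face_corner FFF eaa' exy _ a'xF; rewrite -ya.
Qed.

(** By [face_fiber_step], adjacent fibers cut [F] in the same set of second
    coordinates; as [F] is connected, all the fibers that meet [F] do. *)
Lemma face_rectangle F a a' b b' : F \in FF ->
  mk a b \in F -> mk a' b' \in F -> mk a b' \in F.
Proof.
move=> FFF abF a'b'F.
pose X := [set x in F | [forall c, (mk (p1 x) c \in F) == (mk a c \in F)]].
suff XF : X = F.
  move: a'b'F; rewrite -{1}XF inE p1K => /andP[a'b'F /forallP/(_ b')].
  by rewrite a'b'F => /eqP <-.
apply: (face_connected e_sym e_irr FS FFF _ _ _).
- by apply/set0Pn; exists (mk a b); rewrite inE abF p1K; apply/forallP.
- by apply/subsetP => x; rewrite inE => /andP[].
move=> x y; rewrite -(mkK x) -(mkK y) !inE !p1K (product_adj Vprod).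
move=> /andP[xF /forallP Hx] yF; rewrite yF /=.
case/orP => [/andP[/eqP <- _]|/andP[/eqP eqxy exy]]; first exact/forallP.
apply/forallP => c; rewrite -(eqP (Hx c)) eq_sym.
rewrite eqxy in xF; apply/eqP; apply/idP/idP => H.
  exact: face_fiber_step FFF exy xF yF H.
by apply: face_fiber_step FFF _ yF xF H; rewrite (prod_symA Vprod).
Qed.

(** The cylinder is the face spanned at a point [v] of the slice [S0] by the
    edges of [S0] and those of the fiber [L] through [v] in the other
    direction: it contains both, and by [face_rectangle] it is a product. *)
Lemma cylinder_face (S : {set A}) a0 b0 : a0 \in S ->
  [set x | (p1 x \in S) && (p2 x == b0)] \in FF -> [set x | p1 x \in S] \in FF.
Proof.
move=> a0S S0FF; set S0 := finset _ in S0FF; set v := mk a0 b0.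
pose L := [set x | p1 x == p1 v].
have LFF : L \in FF by exact: fiber1_face.
have MFF : [set x | p2 x == p2 v] \in FF by exact: fiber_face Vprod v.
set M := finset _ in MFF.
have vS0 : v \in S0 by rewrite inE p1K a0S p2K eqxx.
have [F [FFF vF Fv]] := fs_span FS (subsetIr (S0 :|: L) (nbrs e v)).
have vL : v \in L by rewrite inE.
have vM : v \in M by rewrite inE.
have LF : L \subset F.
  apply: (fs_sub FS LFF FFF vL vF); apply: subset_trans (subsetIl F (nbrs e v)).
  by rewrite Fv setSI // subsetUr.
have S0F : S0 \subset F.
  apply: (fs_sub FS S0FF FFF vS0 vF).
  apply: subset_trans (subsetIl F (nbrs e v)).
  by rewrite Fv setSI // subsetUl.
have FS0 : F :&: M \subset S0.
  apply: (fs_sub FS (fs_cap FS FFF MFF) S0FF _ vS0); first by rewrite inE vF.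
  apply/subsetP => x; rewrite setIAC Fv !inE !p1K !p2K.
  by case/andP => /andP[/orP[/andP[-> _]|/eqP ->] _] ->; rewrite ?a0S.
suff <- : F = [set x | p1 x \in S] by [].
apply/setP => x; rewrite inE -(mkK x) p1K; apply/idP/idP => [xF|xS].
  have : mk (p1 x) b0 \in S0.
    apply: (subsetP FS0); rewrite !inE !p2K eqxx andbT.
    exact: face_rectangle FFF xF vF.
  by rewrite inE p1K => /andP[].
apply: (@face_rectangle _ _ a0 b0) => //.
  by apply: (subsetP S0F); rewrite inE p1K p2K xS eqxx.
by apply: (subsetP LF); rewrite inE !p1K.
Qed.

End Rectangles.

Section FaceShape.
Context (A B : finType) (eA : rel A) (eB : rel B).
Context (p1 : V -> A) (p2 : V -> B) (mk : A -> B -> V).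
Hypothesis Vprod : is_product eA eB p1 p2 mk.
Context (a0 : A) (b0 : B).

(** A product is the intersection of two cylinders, and each cylinder can be
    rebuilt from its slice in any fiber. *)
Lemma product_faceP F : F != set0 ->
  (F \in FF <-> exists (S : {set A}) (T : {set B}),
    [/\ S != set0, T != set0,
        [set x | (p1 x \in S) && (p2 x == b0)] \in FF,
        [set x | (p1 x == a0) && (p2 x \in T)] \in FF
      & F = [set x | (p1 x \in S) && (p2 x \in T)]]).
Proof.
have Vprod' := is_product_sym Vprod.
have [p1K p2K mkK _ _ _ _ _] := Vprod.
have fiberB b : [set x | p2 x == b] \in FF.
  by rewrite -(p2K a0 b); apply: fiber_face Vprod _.
have fiberA a : [set x | p1 x == a] \in FF.
  by rewrite -(p1K a b0); apply: fiber_face Vprod' _.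
have capE (P Q : pred V) : [set x | P x] :&: [set x | Q x] = [set x | P x && Q x].
  by apply/setP => x; rewrite !inE.
move=> /set0Pn[v vF]; split=> [FFF|[S [T [/set0Pn[a aS] /set0Pn[b bT] SFF TFF ->]]]].
  rewrite -(mkK v) in vF.
  pose S := [set a | mk a (p2 v) \in F]; pose T := [set b | mk (p1 v) b \in F].
  have FST : F = [set x | (p1 x \in S) && (p2 x \in T)].
    apply/setP => x; rewrite !inE -{1}(mkK x); apply/idP/andP => [xF|[xS xT]].
      by split; [apply: (face_rectangle Vprod) FFF xF vF|
                 apply: (face_rectangle Vprod) FFF vF xF].
    exact: (face_rectangle Vprod) FFF xS xT.
  have vS : p1 v \in S by rewrite inE.
  have vT : p2 v \in T by rewrite inE.
  have cylS : [set x | p1 x \in S] \in FF.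
    apply: (cylinder_face Vprod (b0 := p2 v) vS).
    have := fs_cap FS FFF (fiberB (p2 v)); rewrite {1}FST capE.
    congr (_ \in FF); apply/setP => x; rewrite !inE.
    by case: eqP => [->|]; rewrite ?andbF // !andbT vF andbT.
  have cylT : [set x | p2 x \in T] \in FF.
    apply: (cylinder_face Vprod' (b0 := p1 v) vT).
    have := fs_cap FS FFF (fiberA (p1 v)); rewrite {1}FST capE.
    congr (_ \in FF); apply/setP => x; rewrite !inE.
    by case: eqP => [->|]; rewrite ?andbF // !andbT vF.
  exists S, T; split=> //.
  - by apply/set0Pn; exists (p1 v).
  - by apply/set0Pn; exists (p2 v).
  - by rewrite -capE; apply: fs_cap FS _ _ cylS _.
  - by rewrite -capE; apply: fs_cap FS _ _ _ cylT.
rewrite -capE; apply: fs_cap FS _ _ _ _.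
  exact: (cylinder_face Vprod aS SFF).
apply: (cylinder_face Vprod' (b0 := a0) bT).
by congr (_ \in FF): TFF; apply/setP => x; rewrite !inE andbC.
Qed.

End FaceShape.
End ProductFaces.

Lemma cart_is_product (G H : sgraph) :
  is_product (@cart_adj G H) (@adj G) (@adj H) fst snd (fun g h => (g, h)).
Proof.
split=> //; [by case|exact: adj_sym|exact: adj_sym|exact: adj_irr|exact: adj_irr].
Qed.

Local Open Scope classical_set_scope.

(** * Hulls, Farkas' lemma and faces *)
Section Linear.
Context {R : realType} {n : nat}.
Implicit Types (c d : 'cV[R]_n) (x y : 'rV[R]_n).

Lemma linD c x y : lin c (x + y) = lin c x + lin c y.
Proof. by rewrite /lin mulmxDl mxE. Qed.

Lemma linN c x : lin c (- x) = - lin c x.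
Proof. by rewrite /lin mulNmx mxE. Qed.

Lemma linB c x y : lin c (x - y) = lin c x - lin c y.
Proof. by rewrite linD linN. Qed.

Lemma linZ c a x : lin c (a *: x) = a * lin c x.
Proof. by rewrite /lin -scalemxAl mxE. Qed.

Lemma lin_sum c (I : Type) (r : seq I) (P : pred I) (F : I -> 'rV[R]_n) :
  lin c (\sum_(i <- r | P i) F i) = \sum_(i <- r | P i) lin c (F i).
Proof. by rewrite /lin mulmx_suml summxE. Qed.

Lemma linDc c d x : lin (c + d) x = lin c x + lin d x.
Proof. by rewrite /lin mulmxDr mxE. Qed.

Lemma linNc c x : lin (- c) x = - lin c x.
Proof. by rewrite /lin mulmxN mxE. Qed.

Lemma linZc a c x : lin (a *: c) x = a * lin c x.
Proof. by rewrite /lin -scalemxAr mxE. Qed.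

Lemma lin_sumc (I : Type) (r : seq I) (P : pred I) (F : I -> 'cV[R]_n) x :
  lin (\sum_(i <- r | P i) F i) x = \sum_(i <- r | P i) lin (F i) x.
Proof. by rewrite /lin mulmx_sumr summxE. Qed.

Lemma lin0 c : lin c 0 = 0.
Proof. by rewrite /lin mul0mx mxE. Qed.

Lemma lin0c x : lin 0 x = 0.
Proof. by rewrite /lin mulmx0 mxE. Qed.

End Linear.

Section Hulls.
Context {R : realType}.

Section Farkas.
Context {V : finType}.

(** Bartl's algebraic proof, by induction on the number of vectors.  If the
    hypothesis fails without [u v], some [c] is nonpositive on the other vectors
    but positive on [w] and on [u v].  Projecting along [u v] onto the kernel of
    [c] preserves the hypothesis, and the coefficient of [u v] that results from
    undoing the projection is nonnegative. *)
Lemma farkas n (u : V -> 'rV[R]_n) (A : {set V}) (w : 'rV[R]_n) :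
  (forall c, (forall v, v \in A -> lin c (u v) <= 0) -> lin c w <= 0) ->
  exists a : V -> R,
    (forall v, 0 <= a v) /\ w = \sum_(v in A) a v *: u v.
Proof.
have [k] := ubnP #|A|; elim: k => // k IHk in A u w * => cardA Hw.
have [A0|[v vA]] := finset.set_0Vmem A.
  exists (fun=> 0); split=> //; rewrite big1 => [|v _]; last by rewrite scale0r.
  apply/rowP => j; rewrite [RHS]mxE; apply/le_anti/andP.
  have linj (s : R) : lin (s *: delta_mx j 0) w = s * w 0 j.
    rewrite linZc /lin mxE (bigD1 j) //= big1 ?addr0 ?mxE ?eqxx ?mulr1 // => i ij.
    by rewrite !mxE (negbTE ij) mulr0.
  have Hj s : s * w 0 j <= 0.
    by rewrite -linj; apply: Hw => v; rewrite A0 finset.in_set0.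
  by have := Hj 1; have := Hj (-1); rewrite mul1r mulN1r oppr_le0.
have cardA' : (#|A :\ v| < k)%N by rewrite (cardsD1 v A) vA in cardA.
have [HA'|] := pselect (forall c, (forall i, i \in A :\ v -> lin c (u i) <= 0) -> lin c w <= 0).
  have [a [a_ge0 ->]] := IHk _ _ _ cardA' HA'.
  exists (fun i => if i == v then 0 else a i); split=> [i|]; first by case: eqP.
  rewrite [RHS](big_setD1 v) //= eqxx scale0r add0r.
  by apply: eq_bigr => i; rewrite !inE => /andP[/negbTE ->].
move=> /existsNP[c /not_implyP[cu /negP]]; rewrite -ltNge => cw.
have cv : 0 < lin c (u v).
  rewrite ltNge; apply/negP => cv; move: cw; rewrite ltNge Hw // => i iA.
  by have [->//|iv] := eqVneq i v; apply: cu; rewrite !inE iv.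
pose d := (lin c (u v))^-1 *: c.
have dv : lin d (u v) = 1 by rewrite linZc mulVf // gt_eqF.
have dw : 0 < lin d w by rewrite linZc mulr_gt0 // invr_gt0.
have du i : i \in A :\ v -> lin d (u i) <= 0.
  by move=> iA; rewrite linZc pmulr_rle0 ?invr_gt0 ?cu.
pose pr (x : 'rV[R]_n) : 'rV[R]_n := x - lin d x *: u v.
have lin_pr e x : lin e (pr x) = lin (e - lin e (u v) *: d) x.
  by rewrite /pr linB linZ linDc linNc [in RHS]linZc mulrC.
have [|a [a_ge0 aw]] := IHk _ (pr \o u) (pr w) cardA'.
  move=> e He; rewrite lin_pr; apply: Hw => i iA.
  have [->|iv] := eqVneq i v; first by rewrite linDc linNc linZc dv mulr1 subrr.
  by rewrite -lin_pr; apply: He; rewrite !inE iv.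
pose av := lin d w - \sum_(i in A :\ v) a i * lin d (u i).
have av_ge0 : 0 <= av.
  rewrite subr_ge0 (le_trans _ (ltW dw)) // sumr_le0 // => i iA.
  by rewrite mulr_ge0_le0 ?du.
exists (fun i => if i == v then av else a i); split=> [i|]; first by case: eqP.
rewrite (big_setD1 v) //= eqxx.
under eq_bigr => i do [rewrite !inE => /andP[/negbTE -> _]].
have -> : w = lin d w *: u v + pr w by rewrite /pr addrC subrK.
rewrite aw /= /pr; under eq_bigr => i _ do rewrite scalerBr scalerA.
by rewrite sumrB -scaler_suml addrA addrAC -scalerBl.
Qed.

End Farkas.

(** [conv_hull] for points indexed by a subset of any finite type; it makes the
    passage to faces a change of the index set. *)
Definition hull n (V : finType) (f : V -> 'rV[R]_n) (A : {set V}) :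
    set 'rV[R]_n :=
  [set p | exists a : V -> R, [/\ forall v, 0 <= a v, \sum_(v in A) a v = 1
                                & p = \sum_(v in A) a v *: f v]].

Lemma conv_hullE n k (x : 'I_k -> 'rV[R]_n) : conv_hull x = hull x finset.setT.
Proof.
have sumT (M : nmodType) (F : 'I_k -> M) :
    \sum_(i in [set: 'I_k]%SET) F i = \sum_i F i.
  by apply: eq_bigl => i; rewrite finset.in_setT.
by apply/seteqP; split=> p [a [a0 a1 ->]]; exists a; split; rewrite ?sumT // -a1 sumT.
Qed.

Section HullTheory.
Context {n : nat} {V : finType} (f : V -> 'rV[R]_n).
Implicit Types (A B : {set V}) (c : 'cV[R]_n) (b : R).

Lemma hull_enum A : hull f A = conv_hull (fun i : 'I_#|A| => f (enum_val i)).
Proof.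
apply/seteqP; split=> p [a [a0 a1 ->]].
  exists (a \o enum_val); split=> [i||]; rewrite ?a0 //.
    by rewrite -a1 [RHS]big_enum_val.
  by rewrite [LHS]big_enum_val.
have [A0|[v0 v0A]] := finset.set_0Vmem A.
  have cA : #|A| = 0%N by rewrite A0 cards0.
  exfalso; move/eqP: a1; rewrite big1 ?(eq_sym 0) ?oner_eq0 //= => i.
  by have := ltn_ord i; rewrite [X in (_ < X)%N -> _]cA.
exists (fun v => if v \in A then a (enum_rank_in v0A v) else 0); split.
- by move=> v; case: ifP.
- rewrite -a1 [LHS]big_enum_val /=; apply: eq_bigr => i _.
  by rewrite enum_valP enum_valK_in.
- rewrite [RHS]big_enum_val /=; apply: eq_bigr => i _.
  by rewrite enum_valP enum_valK_in.
Qed.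

Lemma polytope_hull A : polytope (hull f A).
Proof. by exists #|A|, (fun i => f (enum_val i)); rewrite hull_enum. Qed.

Lemma hull_gen A v : v \in A -> hull f A (f v).
Proof.
move=> vA; exists (fun w => (w == v)%:R); split=> [w||].
- exact: ler0n.
- by rewrite (big_setD1 v) //= eqxx big1 ?addr0 // => w; rewrite !inE => /andP[/negbTE ->].
- rewrite (big_setD1 v) //= eqxx scale1r big1 ?addr0 // => w.
  by rewrite !inE => /andP[/negbTE ->]; rewrite scale0r.
Qed.

Lemma hull_nonempty A p : hull f A p -> exists v, v \in A.
Proof.
case=> a [_ a1 _]; have [A0|[v vA]] := finset.set_0Vmem A; last by exists v.
by move/eqP: a1; rewrite A0 finset.big_set0 eq_sym oner_eq0.
Qed.

Lemma hull_subset A B : A \subset B -> hull f A `<=` hull f B.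
Proof.
move=> AB p [a [a0 a1 ->]].
have ind (M : nmodType) (F : V -> R -> M) : (forall v, F v 0 = 0) ->
    \sum_(v in B) F v (if v \in A then a v else 0) = \sum_(v in A) F v (a v).
  move=> F0; rewrite (big_setID A) /= (finset.setIidPr AB) [X in _ + X]big1 ?addr0.
    by apply: eq_bigr => v ->.
  by move=> v; rewrite inE => /andP[/negbTE -> _].
exists (fun v => if v \in A then a v else 0); split.
- by move=> v; case: ifP.
- by rewrite (ind _ (fun=> id)).
- by rewrite (ind _ (fun v r => r *: f v)) // => v; rewrite scale0r.
Qed.

Lemma hull_hull (I : finType) (B : {set I}) (x : I -> 'rV[R]_n) A :
  (forall i, i \in B -> hull f A (x i)) -> hull x B `<=` hull f A.
Proof.
move=> xA p [b [b0 b1 ->]].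
have /choice[a aP] : forall i, exists a : V -> R, i \in B ->
    [/\ forall v, 0 <= a v, \sum_(v in A) a v = 1 & x i = \sum_(v in A) a v *: f v].
  move=> i; have [/xA[a aP]|iB] := boolP (i \in B); first by exists a.
  by exists (fun=> 0).
exists (fun v => \sum_(i in B) b i * a i v); split.
- by move=> v; apply: sumr_ge0 => i /aP[a0 _ _]; rewrite mulr_ge0.
- rewrite exchange_big /= -b1; apply: eq_bigr => i /aP[_ a1 _].
  by rewrite -mulr_sumr a1 mulr1.
under [RHS]eq_bigr do rewrite scaler_suml.
rewrite exchange_big; apply: eq_bigr => i /aP[_ _ ->].
by rewrite scaler_sumr; apply: eq_bigr => v _; rewrite scalerA.
Qed.

Lemma lin_hull_le c b A p : (forall v, v \in A -> lin c (f v) <= b) ->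
  hull f A p -> lin c p <= b.
Proof.
move=> cA [a [a0 a1 ->]]; rewrite lin_sum -[leRHS]mul1r -a1 mulr_suml.
by apply: ler_sum => v vA; rewrite linZ ler_wpM2l ?cA.
Qed.

(** On the hyperplane, the weights multiply nonnegative slacks to a zero sum, so
    only the points on the hyperplane can have a positive weight. *)
Lemma hull_lin_eq c b A : (forall v, v \in A -> lin c (f v) <= b) ->
  hull f A `&` [set x | lin c x = b] = hull f [set v in A | lin c (f v) == b]%SET.
Proof.
move=> cA; set A' := finset _; have A'A : A' \subset A.
  by apply/fintype.subsetP => v; rewrite inE => /andP[].
apply/seteqP; split=> p; last first.
  move=> pA'; split; first exact: hull_subset A'A _ pA'.
  case: pA' => a [a0 a1 ->]; rewrite /= lin_sum -[RHS]mul1r -a1 mulr_suml.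
  by apply: eq_bigr => v; rewrite inE => /andP[_ /eqP <-]; rewrite linZ.
case=> -[a [a0 a1 ->]] /= cp.
have aD v : v \in A :\: A' -> a v = 0.
  move=> vD; move: (vD); rewrite finset.in_setD => /andP[vA' vA].
  have sum0 : \sum_(v in A) a v * (b - lin c (f v)) = 0.
    under eq_bigr do rewrite mulrBr.
    rewrite sumrB -mulr_suml a1 mul1r -cp lin_sum -sumrB big1 // => w _.
    by rewrite linZ subrr.
  have ge0 w : w \in A -> 0 <= a w * (b - lin c (f w)).
    by move=> wA; rewrite mulr_ge0 // subr_ge0 cA.
  have /eqP := psumr_eq0P ge0 sum0 vA; rewrite mulf_eq0 => /orP[/eqP//|].
  by rewrite subr_eq0 eq_sym => cv; move: vA'; rewrite inE vA cv.
have ind (M : nmodType) (F : V -> M) : (forall v, a v = 0 -> F v = 0) ->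
    \sum_(v in A) F v = \sum_(v in A') F v.
  move=> F0; rewrite (big_setID A') /= (finset.setIidPr A'A) [X in _ + X]big1 ?addr0 //.
  by move=> v /aD/F0.
exists a; split=> //; first by rewrite -ind.
by rewrite ind // => v ->; rewrite scale0r.
Qed.

Lemma face_hullE A F : face (hull f A) F <-> exists c b,
  (forall v, v \in A -> lin c (f v) <= b) /\
  F = hull f [set v in A | lin c (f v) == b]%SET.
Proof.
split=> -[c [b [cA ->]]]; exists c, b; split.
- by move=> v vA; apply/cA/hull_gen.
- by apply: hull_lin_eq => v vA; apply/cA/hull_gen.
- by move=> p; apply: lin_hull_le.
- by rewrite hull_lin_eq.
Qed.

Lemma vertex_hull A p : vertex (hull f A) p -> exists2 v, v \in A & p = f v.
Proof.
move=> /face_hullE[c [b [_ eqp]]].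
have : hull f [set v in A | lin c (f v) == b]%SET p by rewrite -eqp.
move=> /hull_nonempty[v vA']; exists v.
  by move: vA'; rewrite inE => /andP[].
by apply/esym; move: (hull_gen vA'); rewrite -eqp.
Qed.

End HullTheory.
End Hulls.

(** * Polytopes as point configurations *)
Section VertexSets.
Context {R : realType}.

(** The vertex sets of the faces of the hull of [f], when [f] enumerates its
    vertices. *)
Definition vfaces n (V : finType) (f : V -> 'rV[R]_n) : {set {set V}} :=
  [set A : {set V} | `[< exists (c : 'cV[R]_n) (b : R),
     (forall v, lin c (f v) <= b) /\ A = [set v | lin c (f v) == b]%SET >]]%SET.

(** The second condition says that [f] lists vertices, without repetition. *)
Definition spans n (V : finType) (P : set 'rV[R]_n) (f : V -> 'rV[R]_n) : Prop :=
  P = hull f finset.setT /\ forall v, [set v]%SET \in vfaces f.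

Definition vset n (V : finType) (f : V -> 'rV[R]_n) (F : set 'rV[R]_n) : {set V} :=
  [set v | `[< F (f v) >]]%SET.

Section OnePolytope.
Context {n : nat} {V : finType} (f : V -> 'rV[R]_n).
Implicit Types (A B : {set V}) (c : 'cV[R]_n) (b : R) (F : set 'rV[R]_n).

Lemma vfacesP A : reflect (exists c b,
  (forall v, lin c (f v) <= b) /\ A = [set v | lin c (f v) == b]%SET)
  (A \in vfaces f).
Proof. by rewrite inE; apply: asboolP. Qed.

Lemma set0_vfaces : finset.set0 \in vfaces f.
Proof.
apply/vfacesP; exists 0, 1; split=> [v|]; first by rewrite lin0c.
by apply/setP => v; rewrite !inE lin0c eq_sym oner_eq0.
Qed.

Lemma setT_vfaces : finset.setT \in vfaces f.
Proof.
apply/vfacesP; exists 0, 0; split=> [v|]; first by rewrite lin0c.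
by apply/setP => v; rewrite !inE lin0c eqxx.
Qed.

Lemma vfaces_cap A B : A \in vfaces f -> B \in vfaces f -> A :&: B \in vfaces f.
Proof.
move=> /vfacesP[c [b [cb ->]]] /vfacesP[c' [b' [cb' ->]]].
apply/vfacesP; exists (c + c'), (b + b'); split=> [v|].
  by rewrite linDc lerD.
apply/setP => v; rewrite !inE linDc; have := cb v; have := cb' v.
by move=> ? ?; apply/andP/eqP => [[/eqP -> /eqP ->]//|?]; split; apply/eqP; lra.
Qed.

Section Spanned.
Context (P : set 'rV[R]_n).
Hypothesis Pf : spans P f.

Lemma hull_vset A : vset f (hull f A) = A.
Proof.
apply/setP => v; rewrite inE; apply/asboolP/idP => [vA|]; last exact: hull_gen.
have /vfacesP[c [b [cb vE]]] := Pf.2 v.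
have : (hull f A `&` [set x | lin c x = b]) (f v).
  split=> //=; apply/eqP; have : v \in [set v]%SET by rewrite inE.
  by rewrite vE inE.
rewrite hull_lin_eq // => /hull_nonempty[w]; rewrite inE => /andP[wA cw].
have : w \in [set v]%SET by rewrite vE inE.
by rewrite inE => /eqP <-.
Qed.

Lemma spans_inj : injective f.
Proof.
move=> u v fuv; have /vfacesP[c [b [_ vE]]] := Pf.2 v.
apply/eqP; rewrite -finset.in_set1 vE inE fuv.
by have := finset.set11 v; rewrite vE inE.
Qed.

Lemma face_spans F : face P F <-> exists2 A, A \in vfaces f & F = hull f A.
Proof.
have setE (c : 'cV[R]_n) (b : R) : [set v in [set: V] | lin c (f v) == b]%SET =
    [set v | lin c (f v) == b]%SET.
  by apply/setP => v; rewrite !inE.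
rewrite Pf.1 face_hullE; split=> [[c [b [cb ->]]]|[A /vfacesP[c [b [cb ->]]] ->]].
  exists [set v | lin c (f v) == b]%SET; last by rewrite setE.
  by apply/vfacesP; exists c, b; split=> // v; apply: cb; rewrite inE.
by exists c, b; rewrite setE.
Qed.

Lemma vertex_spans p : vertex P p <-> exists v, p = f v.
Proof.
split=> [|[v ->]].
  by rewrite Pf.1 => /vertex_hull[v _ ->]; exists v.
apply/face_spans; exists [set v]%SET; first exact: Pf.2.
apply/seteqP; split=> [_ ->|q [a [_]]]; first by apply: hull_gen; rewrite inE.
by rewrite !finset.big_set1 => -> ->; rewrite scale1r.
Qed.

Lemma spans_polytope : polytope P.
Proof. by rewrite Pf.1; apply: polytope_hull. Qed.

Lemma spans_bij : set_bij setT (vertex P) f.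
Proof.
split.
- by move=> v _; apply/vertex_spans; exists v.
- by move=> u v _ _; apply: spans_inj.
- by move=> p /vertex_spans[v ->]; exists v.
Qed.

End Spanned.
End OnePolytope.

Lemma row_mx_sum m n (I : Type) (r : seq I) (P : pred I)
    (F : I -> 'rV[R]_m) (G : I -> 'rV[R]_n) :
  row_mx (\sum_(i <- r | P i) F i) (\sum_(i <- r | P i) G i) =
  \sum_(i <- r | P i) row_mx (F i) (G i).
Proof.
elim/big_rec3: _ => [|i x y z _ <-]; first by rewrite row_mx0.
by rewrite add_row_mx.
Qed.

(** Farkas' lemma, for the vectors [x j - x i] with an extra coordinate 1 and the
    last basis vector: either the weights express [x i] in terms of the other
    points, or some functional is negative on all the [x j - x i]. *)
Lemma vertices_separated n (V : finType) (x : V -> 'rV[R]_n) (A : {set V}) i :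
  i \in A -> ~ hull x (A :\ i) (x i) -> vertex (hull x A) (x i).
Proof.
move=> iA xi.
pose u j := row_mx (x j - x i) (1%:M : 'M[R]_1).
pose w : 'rV[R]_(n + 1) := row_mx 0 1%:M.
have [H|] := pselect (forall c, (forall j, j \in A :\ i -> lin c (u j) <= 0) -> lin c w <= 0).
  have [a [a0 wE]] := farkas H; exfalso; apply: xi; exists a.
  have [wl wr] : 0 = \sum_(j in A :\ i) a j *: (x j - x i) /\
      1%:M = \sum_(j in A :\ i) a j *: (1%:M : 'M[R]_1).
    move: wE; under eq_bigr do rewrite /u scale_row_mx.
    by rewrite -row_mx_sum => /eq_row_mx.
  have a1 : \sum_(j in A :\ i) a j = 1.
    move: wr; rewrite -scaler_suml => /matrixP/(_ 0 0).
    by rewrite !mxE eqxx mulr1.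
  split=> //; apply/eqP; rewrite eq_sym -subr_eq0; apply/eqP.
  rewrite {1}(_ : x i = \sum_(j in A :\ i) a j *: x i); last first.
    by rewrite -scaler_suml a1 scale1r.
  by rewrite -sumrB [RHS]wl; apply: eq_bigr => j _; rewrite scalerBr.
move=> /existsNP[c /not_implyP[cu /negP]]; rewrite -ltNge => cw.
pose c1 := usubmx c; pose t := dsubmx c 0 0.
have linE (y : 'rV_n) (z : 'M_1) : lin c (row_mx y z) = lin c1 y + z 0 0 * t.
  by rewrite /lin -[c in LHS]vsubmxK mul_row_col mxE [X in _ + X]mxE big_ord1.
move: cw; rewrite linE /lin mul0mx !mxE eqxx mul1r add0r => t0.
have cx j : j \in A :\ i -> lin c1 (x j) < lin c1 (x i).
  by move/cu; rewrite linE linB !mxE eqxx mul1r => ?; lra.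
apply/face_hullE; exists c1, (lin c1 (x i)); split=> [v vA|].
  by have [->//|vi] := eqVneq v i; rewrite ltW // cx // !inE vi.
rewrite (_ : finset _ = [set i]%SET); last first.
  apply/setP => v; rewrite !inE; apply/andP/eqP => [[vA]|->//].
  by apply: contraTeq => vi; rewrite lt_eqF // cx // !inE vi.
apply/seteqP; split=> [_ ->|q [a [_]]]; first by apply: hull_gen; rewrite inE.
by rewrite !finset.big_set1 => -> ->; rewrite scale1r.
Qed.

(** In a minimal set of generators no point is in the hull of the others, so all
    of them are vertices. *)
Lemma polytope_spans n (V : finType) (P : set 'rV[R]_n) (f : V -> 'rV[R]_n) :
  polytope P -> set_bij setT (vertex P) f -> spans P f.
Proof.
move=> [k [x PE]] [fV finj fsurj].
have fP v : P (f v) by have [c [b [_ E]]] := fV v I; have : [set f v] (f v) by []; rewrite E => -[].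
have P_setT : `[< hull x [set: 'I_k]%SET = P >] by apply/asboolP; rewrite PE conv_hullE.
have [A /asboolP AP Amin] := @arg_minnP _ [set: 'I_k]%SET
  (fun A => `[< hull x A = P >]) (fun A => #|A|) P_setT.
have xA i : i \in A -> vertex P (x i).
  move=> iA; rewrite -AP; apply: vertices_separated => // xi.
  have : `[< hull x (A :\ i) = P >].
    apply/asboolP; rewrite -AP; apply/seteqP; split.
      by apply: hull_subset; apply: finset.subD1set.
    apply: hull_hull => j jA; have [->//|ji] := eqVneq j i.
    by apply: hull_gen; rewrite !inE ji.
  by move/Amin; rewrite [X in (X <= _)%N](cardsD1 i) iA ltnn.
have PE' : P = hull f finset.setT.
  apply/seteqP; split.
    rewrite -AP; apply: hull_hull => i /xA/fsurj[v _ <-].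
    by apply: hull_gen; rewrite inE.
  by rewrite -AP; apply: hull_hull => v _; rewrite AP.
split=> // v; have := fV v I; rewrite PE' => /face_hullE[c [b [cb vE]]].
apply/vfacesP; exists c, b; split=> [w|]; first by apply: cb; rewrite inE.
apply/setP => w; rewrite !inE; apply/eqP/idP => [->|cw].
  have : [set f v] (f v) by [].
  rewrite vE -hull_lin_eq => [[_ /= cv]|? _]; last by apply: cb; rewrite inE.
  exact/eqP.
apply: finj; rewrite ?inE //; have : hull f [set v in [set: V] | lin c (f v) == b]%SET (f w).
  by apply: hull_gen; rewrite !inE.
by rewrite -vE.
Qed.

End VertexSets.

(** * Edges, combinatorial equivalence, faces of faces, products *)
Section GraphsAndFaces.
Context {R : realType}.

Section Adjacency.
Context {n : nat} {V : finType} (f : V -> 'rV[R]_n) (P : set 'rV[R]_n).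
Hypothesis Pf : spans P f.
Implicit Types (A B : {set V}).

Lemma hull_subE A B : hull f A `<=` hull f B <-> A \subset B.
Proof.
split=> [AB|]; last exact: hull_subset.
apply/fintype.subsetP => v vA; rewrite -(hull_vset Pf B) inE; apply/asboolP.
exact/AB/hull_gen.
Qed.

Lemma strict_support u : exists (c : 'cV[R]_n) (b : R),
  lin c (f u) = b /\ forall v, v != u -> lin c (f v) < b.
Proof.
have /vfacesP[c [b [cb uE]]] := Pf.2 u; exists c, b; split.
  by have := finset.set11 u; rewrite uE inE => /eqP.
move=> v vu; rewrite lt_neqAle cb andbT; apply: contra vu => cv.
by rewrite -finset.in_set1 uE inE.
Qed.

(** Applying to the relation a functional with maximum at just one of the three
    points shows that the other two coefficients have opposite signs, or both
    vanish; this cannot hold for all three pairs unless all are 0. *)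
Lemma aff_indep3 u v w (a b c : R) : u != v -> u != w -> v != w ->
  a + b + c = 0 -> a *: f u + b *: f v + c *: f w = 0 ->
  [/\ a = 0, b = 0 & c = 0].
Proof.
have opp x y z (r s t : R) : y != x -> z != x -> r + s + t = 0 ->
    r *: f x + s *: f y + t *: f z = 0 ->
    exists d d', [/\ 0 < d, 0 < d' & s * d + t * d' = 0].
  move=> yx zx sum0 comb0; have [e [k [ex ek]]] := strict_support x.
  exists (k - lin e (f y)), (k - lin e (f z)); rewrite !subr_gt0 !ek //; split=> //.
  have := congr1 (lin e) comb0; rewrite !linD !linZ ex lin0.
  have -> : r = - s - t by lra.
  lra.
move=> uv uw vw sum0 comb0.
have [vu wu wv] : [/\ v != u, w != u & w != v] by rewrite !(eq_sym w) eq_sym.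
have [d1 [d2 [d1p d2p E1]]] := opp u v w a b c vu wu sum0 comb0.
have [d3 [d4 [d3p d4p E2]]] : exists d d', [/\ 0 < d, 0 < d' & a * d + c * d' = 0].
  apply: (opp v u w b) => //; first by rewrite -sum0 [b + a]addrC.
  by rewrite -comb0 [b *: _ + _]addrC.
have [d5 [d6 [d5p d6p E3]]] : exists d d', [/\ 0 < d, 0 < d' & a * d + b * d' = 0].
  apply: (opp w u v c) => //; first by rewrite -sum0; ring.
  by rewrite -comb0 -addrA addrC.
have sgn (x y d d' : R) : 0 < d -> 0 < d' -> x * d + y * d' = 0 ->
    [/\ 0 < x -> y < 0, x < 0 -> 0 < y & x = 0 -> y = 0].
  move=> dp dp' Exy; have xE : x * d = - (y * d') by lra.
  split=> [x0|x0|x0].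
  - by rewrite -(pmulr_llt0 _ dp') -oppr_gt0 -xE mulr_gt0.
  - by rewrite -(pmulr_lgt0 _ dp') -oppr_lt0 -xE pmulr_llt0.
  - by apply/eqP; move/eqP: xE; rewrite x0 mul0r eq_sym oppr_eq0 mulf_eq0 (gt_eqF dp') orbF.
have [p1 n1 z1] := sgn _ _ _ _ d1p d2p E1.
have [p2 n2 z2] := sgn _ _ _ _ d3p d4p E2.
have [p3 n3 z3] := sgn _ _ _ _ d5p d6p E3.
case: (ltgtP a 0) => [a0|a0|a0].
- by have := p1 (n3 a0); rewrite ltNge ltW // n2.
- by have := n1 (p3 a0); rewrite ltNge ltW // p2.
- by rewrite a0 z3 // z2.
Qed.

(** A face of dimension 1 has exactly two vertices, as three vertices would be
    affinely independent. *)
Lemma polytope_adj_spans u v :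
  polytope_adj P (f u) (f v) <-> u != v /\ [set u; v]%SET \in vfaces f.
Proof.
split=> [[_ _ /eqP fuv [F [[PF [_ dimF]] Fu Fv]]]|[uv uvF]].
  have uv : u != v by apply: contraNneq fuv => ->.
  split=> //; have /(face_spans Pf)[A Af FA] := PF.
  suff <- : A = [set u; v]%SET by [].
  have inA w : F (f w) -> w \in A.
    by move=> Fw; rewrite -(hull_vset Pf A) inE; apply/asboolP; rewrite -FA.
  apply/eqP; rewrite finset.eqEsubset; apply/andP; split; last first.
    by rewrite finset.subUset !finset.sub1set !inA.
  apply/fintype.subsetP => w wA; rewrite !inE; apply: contra_notT dimF.
  rewrite negb_or => /andP[wu wv].
  exists (fun i : 'I_3 => f (nth u [:: u; v; w] i)); split=> [i|a].
    rewrite FA; apply: hull_gen; case: i => -[|[|[|//]]] _ //=; exact: inA.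
  rewrite !big_ord_recl !big_ord0 /= !addr0 !addrA => s0 c0 i.
  have [uw vw] : u != w /\ v != w by rewrite !(eq_sym _ w).
  have [a0 a1 a2] := aff_indep3 uv uw vw s0 c0.
  case: i => -[|[|[|//]]] lti.
  - by rewrite -[RHS]a0; congr a; apply: val_inj.
  - by rewrite -[RHS]a1; congr a; apply: val_inj.
  - by rewrite -[RHS]a2; congr a; apply: val_inj.
have Fuv : face P (hull f [set u; v]%SET) by apply/(face_spans Pf); exists [set u; v]%SET.
split; try by apply/(vertex_spans Pf); eexists.
  by move/(spans_inj Pf)/eqP; rewrite (negbTE uv).
exists (hull f [set u; v]%SET); split; try by apply: hull_gen; rewrite !inE eqxx ?orbT.
split=> //; split.
  exists (fun i : 'I_2 => f (nth u [:: u; v] i)); split=> [i|a].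
    by apply: hull_gen; case: i => -[|[|//]] _ /=; rewrite !inE eqxx ?orbT.
  rewrite !big_ord_recl !big_ord0 /= !addr0 => s0 c0.
  have a0 : a ord0 = 0.
    have [e [k [eu ev]]] := strict_support u.
    have := congr1 (lin e) c0; rewrite linD !linZ lin0 eu.
    have -> : a (lift ord0 ord0) = - a ord0 by lra.
    have := ev v; rewrite eq_sym => /(_ uv) lt_ev c0e.
    have /eqP : a ord0 * (k - lin e (f v)) = 0 by lra.
    by rewrite mulf_eq0 => /orP[/eqP//|]; rewrite subr_eq0 (gt_eqF lt_ev).
  move=> i; case: i => -[|[|//]] lti.
  - by rewrite -[RHS]a0; congr a; apply: val_inj.
  - rewrite -[RHS](_ : a (lift ord0 ord0) = 0); first by congr a; apply: val_inj.
    by lra.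
move=> [x [xuv xind]].
have /choice[s sE] : forall i, exists s : R, x i = f v + s *: (f u - f v).
  have uNv : u \notin [set v]%SET by rewrite inE.
  move=> i; have [a [_]] := xuv i; rewrite !(big_setU1 _ uNv) /= !finset.big_set1.
  move=> a1 ->; exists (a u); have -> : a v = 1 - a u by lra.
  by rewrite scalerBr scalerBl scale1r addrCA.
have dep (a : 'I_3 -> R) : \sum_i a i = 0 -> \sum_i a i * s i = 0 -> forall i, a i = 0.
  move=> sum0 comb0; apply: xind => //.
  under eq_bigr do rewrite sE scalerDr scalerA.
  by rewrite big_split /= -!scaler_suml sum0 comb0 !scale0r addr0.
pose i1 : 'I_3 := lift ord0 ord0; pose i2 : 'I_3 := lift ord0 (lift ord0 ord0).
have dep3 a0 a1 a2 : a0 + a1 + a2 = 0 -> a0 * s ord0 + a1 * s i1 + a2 * s i2 = 0 ->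
    [/\ a0 = 0, a1 = 0 & a2 = 0].
  move=> sum0 comb0; have := dep (fun i => nth 0 [:: a0; a1; a2] i).
  rewrite !big_ord_recl !big_ord0 /= !addr0 !addrA => /(_ sum0 comb0) a_0.
  by split; [have := a_0 ord0|have := a_0 i1|have := a_0 i2].
(* These coefficients are a dependency of any three points of a line; they
   vanish only if the points coincide, when 1, -1, 0 is a dependency. *)
have [s12 s20 _] : [/\ s i1 - s i2 = 0, s i2 - s ord0 = 0 & s ord0 - s i1 = 0].
  by apply: dep3; ring.
by have [/eqP] : [/\ 1 = 0 :> R, -1 = 0 :> R & 0 = 0 :> R];
  [apply: dep3; lra|rewrite oner_eq0].
Qed.

End Adjacency.

(** A face is the hull of its vertex set, and inclusions can be tested on vertex
    sets. *)
Lemma comb_equiv_vfaces n n' (V : finType) (P : set 'rV[R]_n) (P' : set 'rV[R]_n')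
    (f : V -> 'rV[R]_n) (f' : V -> 'rV[R]_n') :
  spans P f -> spans P' f' -> vfaces f = vfaces f' -> comb_equiv P P'.
Proof.
move=> Pf Pf' ff'; exists (fun F => hull f' (vset f F)).
have phiE A : vset f (hull f A) = A by apply: hull_vset Pf A.
split; last first.
  move=> F F' /(face_spans Pf)[A _ ->] /(face_spans Pf)[A' _ ->].
  by rewrite !phiE (hull_subE Pf) (hull_subE Pf').
split.
- move=> F /(face_spans Pf)[A Af ->]; rewrite phiE; apply/(face_spans Pf').
  by exists A => //; rewrite -ff'.
- move=> F F'; rewrite !inE => /(face_spans Pf)[A _ ->] /(face_spans Pf)[A' _ ->].
  rewrite !phiE => /(congr1 (vset f')); rewrite !(hull_vset Pf').
  by move=> ->.
move=> F /(face_spans Pf')[A Af ->]; exists (hull f A); last by rewrite phiE.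
by apply/(face_spans Pf); exists A => //; rewrite ff'.
Qed.

(** For adding to a functional a large multiple of another one, whose strict
    inequalities then prevail. *)
Lemma exists_scaling (V : finType) (d e : V -> R) :
  exists M : R, forall v, 0 < d v -> e v < M * d v.
Proof.
exists (\sum_v `|e v| / `|d v| + 1) => v dv.
rewrite mulrDl mul1r; apply: le_lt_trans (ler_norm _) _.
rewrite -[ltLHS]addr0 ler_ltD // -ler_pdivrMr // (bigD1 v) //=.
by rewrite (gtr0_norm dv) lerDl sumr_ge0 // => w _; rewrite divr_ge0.
Qed.

(** Faces of faces are faces: if [c0] defines the face and [c] a face of it, then
    [M *: c0 + c] defines the latter for [M] large. *)
Lemma vfaces_restrict n (V W : finType) (f : V -> 'rV[R]_n) (i : W -> V) A :
  injective i -> (i @: [set: W] \in vfaces f)%SET ->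
  (A \in vfaces (f \o i)) = (i @: A \in vfaces f)%SET.
Proof.
move=> i_inj /vfacesP[c0 [b0 [cb0 WE]]].
have inW w : lin c0 (f (i w)) = b0.
  have : i w \in (i @: [set: W])%SET by apply: finset.imset_f; rewrite inE.
  by rewrite WE inE => /eqP.
apply/vfacesP/vfacesP => -[c [b [cb AE]]]; last first.
  exists c, b; split=> [w|]; first exact: cb.
  by apply/setP => w; rewrite inE -(finset.mem_imset _ _ i_inj) AE inE.
have [M HM] := exists_scaling (fun v => b0 - lin c0 (f v)) (fun v => lin c (f v) - b).
have strict v : lin c0 (f v) < b0 -> M * lin c0 (f v) + lin c (f v) < M * b0 + b.
  by move=> v0; have := HM v; rewrite subr_gt0 => /(_ v0); rewrite mulrBr; lra.
have inW' v : lin c0 (f v) = b0 -> exists w, v = i w.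
  move=> /eqP v0; have : v \in (i @: [set: W])%SET by rewrite WE inE.
  by move=> /finset.imsetP[w _ ->]; exists w.
exists (M *: c0 + c), (M * b0 + b); split=> [v|].
  rewrite linDc linZc; have [/inW'[w ->]|v0] := eqVneq (lin c0 (f v)) b0.
    by rewrite inW lerD2l cb.
  by apply/ltW/strict; rewrite lt_neqAle v0 cb0.
apply/setP => v; rewrite inE linDc linZc.
have [/inW'[w ->]|v0] := eqVneq (lin c0 (f v)) b0.
  rewrite inW (finset.mem_imset _ _ i_inj) AE inE /=.
  by rewrite (inj_eq (addrI _)).
rewrite lt_eqF ?strict // ?lt_neqAle ?v0 ?cb0 //.
by apply/negP => /finset.imsetP[w _ vw]; rewrite vw inW eqxx in v0.
Qed.

Section ProductPoints.
Context {m n : nat} {V W : finType} (f : V -> 'rV[R]_m) (g : W -> 'rV[R]_n).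

Definition prod_points (p : V * W) : 'rV[R]_(m + n) := row_mx (f p.1) (g p.2).

Lemma lin_row_mx (c : 'cV[R]_m) (d : 'cV[R]_n) x y :
  lin (col_mx c d) (row_mx x y) = lin c x + lin d y.
Proof. by rewrite /lin mul_row_col mxE. Qed.

(** If [(v0, w0)] maximizes a functional on the product, then [v0] and [w0]
    maximize its two components. *)
Lemma vfaces_prod (A : {set V * W}) : A != finset.set0 ->
  (A \in vfaces prod_points) <-> exists (S : {set V}) (T : {set W}),
    [/\ S != finset.set0, T != finset.set0, S \in vfaces f, T \in vfaces g
      & A = [set p | (p.1 \in S) && (p.2 \in T)]%SET].
Proof.
move=> /finset.set0Pn[[v0 w0] vwA]; split; last first.
  move=> [S [T [_ _ /vfacesP[c [b [cb ->]]] /vfacesP[d [k [dk ->]]] ->]]].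
  apply/vfacesP; exists (col_mx c d), (b + k); split=> [p|].
    by rewrite lin_row_mx lerD.
  apply/setP => p; rewrite !inE lin_row_mx; have := cb p.1; have := dk p.2.
  by move=> ? ?; apply/andP/eqP => [[/eqP -> /eqP ->]//|?]; split; apply/eqP; lra.
move=> /vfacesP[c [b [cb AE]]].
rewrite -[c]vsubmxK in cb AE; set c1 := usubmx c in cb AE; set c2 := dsubmx c in cb AE.
have b0 : lin c1 (f v0) + lin c2 (g w0) = b.
  by move: vwA; rewrite AE inE lin_row_mx => /eqP.
have cv v : lin c1 (f v) <= lin c1 (f v0).
  by have := cb (v, w0); rewrite lin_row_mx -b0 lerD2r.
have cw w : lin c2 (g w) <= lin c2 (g w0).
  by have := cb (v0, w); rewrite lin_row_mx -b0 lerD2l.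
exists [set v | lin c1 (f v) == lin c1 (f v0)]%SET.
exists [set w | lin c2 (g w) == lin c2 (g w0)]%SET; split.
- by apply/finset.set0Pn; exists v0; rewrite inE.
- by apply/finset.set0Pn; exists w0; rewrite inE.
- by apply/vfacesP; exists c1, (lin c1 (f v0)).
- by apply/vfacesP; exists c2, (lin c2 (g w0)).
apply/setP => p; rewrite AE !inE lin_row_mx; have := cv p.1; have := cw p.2.
by move=> ? ?; apply/eqP/andP => [?|[/eqP -> /eqP ->]//]; split; apply/eqP; lra.
Qed.

Lemma hull_prod :
  hull prod_points finset.setT =
  polytope_prod (hull f finset.setT) (hull g finset.setT).
Proof.
have sumT (I : finType) (M : nmodType) (F : I -> M) :
    \sum_(i in finset.setT) F i = \sum_i F i.
  by apply: eq_bigl => i; rewrite finset.in_setT.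
apply/seteqP; split=> [_ [a [a0 a1 ->]]|_ [_ [a [a0 a1 ->]] [_ [b [b0 b1 ->]] <-]]].
  rewrite sumT in a1.
  rewrite sumT /prod_points; under eq_bigr do rewrite scale_row_mx.
  rewrite -row_mx_sum; eexists; last first.
    eexists; last by reflexivity.
    exists (fun w => \sum_v a (v, w)); split.
    - by move=> w; apply: sumr_ge0.
    - by rewrite sumT exchange_big pair_bigA -[RHS]a1; apply: eq_bigr => -[].
    rewrite sumT; under [RHS]eq_bigr do rewrite scaler_suml.
    by rewrite exchange_big pair_bigA; apply: eq_bigr => -[].
  exists (fun v => \sum_w a (v, w)); split.
  - by move=> v; apply: sumr_ge0.
  - by rewrite sumT pair_bigA -[RHS]a1; apply: eq_bigr => -[].
  rewrite sumT; under [RHS]eq_bigr do rewrite scaler_suml.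
  by rewrite pair_bigA; apply: eq_bigr => -[].
rewrite sumT in a1; rewrite sumT in b1.
exists (fun p => a p.1 * b p.2); split.
- by move=> p; rewrite mulr_ge0.
- rewrite sumT -(pair_bigA _ (fun v w => a v * b w)) /= -[RHS]a1.
  by apply: eq_bigr => v _; rewrite -mulr_sumr b1 mulr1.
rewrite !sumT -(pair_bigA _ (fun v w => (a v * b w) *: prod_points (v, w))) /=.
rewrite /prod_points; under [RHS]eq_bigr do under eq_bigr do rewrite scale_row_mx.
under [RHS]eq_bigr do rewrite -row_mx_sum.
rewrite -row_mx_sum; congr row_mx; last first.
  rewrite [RHS]exchange_big; apply: eq_bigr => w _ /=.
  by rewrite -scaler_suml -mulr_suml a1 mul1r.
by apply: eq_bigr => v _; rewrite /= -scaler_suml -mulr_sumr b1 mulr1.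
Qed.

Lemma spans_prod Q S : spans Q f -> spans S g ->
  spans (polytope_prod Q S) prod_points.
Proof.
move=> [-> fV] [-> gV]; split=> [|[v w]]; first by rewrite hull_prod.
apply/vfaces_prod; first by apply/finset.set0Pn; exists (v, w); rewrite inE.
exists [set v]%SET, [set w]%SET; split=> //.
- by apply/finset.set0Pn; exists v; rewrite inE.
- by apply/finset.set0Pn; exists w; rewrite inE.
by apply/setP => -[x y]; rewrite !inE.
Qed.

End ProductPoints.
End GraphsAndFaces.

(** * Cones at the vertices of a simple polytope *)
Section SimpleVertices.
Context {R : realType}.

Definition vnbrs n (V : finType) (f : V -> 'rV[R]_n) v : {set V} :=
  [set w | (v != w) && ([set v; w]%SET \in vfaces f)]%SET.

(** The vectors [r i] are linearly independent, as witnessed by the dual family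
    of functionals [c], and [c] gives the coordinates of the points seen from
    [f v], which lie in the cone over the [r i]. *)
Definition simplicial_cone n (V : finType) (f : V -> 'rV[R]_n) (v : V)
    (I : finType) (N : {set I}) (r : I -> 'rV[R]_n) (c : I -> 'cV[R]_n) : Prop :=
  [/\ forall i j, i \in N -> j \in N -> lin (c i) (r j) = (i == j)%:R,
      forall i u, i \in N -> 0 <= lin (c i) (f u - f v)
    & forall u, f u - f v = \sum_(i in N) lin (c i) (f u - f v) *: r i].

Lemma segment_hull n (V : finType) (f : V -> 'rV[R]_n) A x y t :
  hull f A x -> hull f A y -> 0 <= t -> t <= 1 -> hull f A (x + t *: (y - x)).
Proof.
move=> [a [a0 a1 ->]] [b [b0 b1 ->]] t0 t1.
exists (fun v => (1 - t) * a v + t * b v); split.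
- by move=> v; rewrite addr_ge0 ?mulr_ge0 // subr_ge0.
- by rewrite big_split -!mulr_sumr a1 b1 /=; ring.
under [RHS]eq_bigr do rewrite scalerDl -!scalerA.
by rewrite big_split -!scaler_sumr /= scalerBr scalerBl scale1r addrAC -addrA addrCA addrC.
Qed.

Lemma dual_functionals n k (r : 'I_k -> 'rV[R]_n) :
  (forall a : 'I_k -> R, \sum_i a i *: r i = 0 -> forall i, a i = 0) ->
  exists c : 'I_k -> 'cV[R]_n, forall i j, lin (c i) (r j) = (i == j)%:R.
Proof.
move=> r_free; pose M := \matrix_i r i.
have Mfree : row_free M.
  apply: inj_row_free => u; rewrite mulmx_sum_row => u0.
  apply/rowP => i; rewrite [RHS]mxE; apply: r_free.
  by rewrite -[RHS]u0; apply: eq_bigr => j _; rewrite rowK.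
have /row_freeP[C MC] := Mfree.
exists (fun i => col i C) => i j.
have -> : r j = row j M by rewrite rowK.
by rewrite /lin colE mulmxA -row_mul MC !mxE (bigD1 j) //= big1 => [|l /negbTE lj];
  rewrite !mxE ?eqxx ?addr0 ?mul1r ?andbT ?[l == j]eq_sym ?(eq_sym j) ?lj ?mul0r.
Qed.

Section ConeFaces.
Context {n : nat} {V : finType} (f : V -> 'rV[R]_n) (v : V).
Context {I : finType} (N : {set I}) (r : I -> 'rV[R]_n) (c : I -> 'cV[R]_n).
Hypothesis cone : simplicial_cone f v N r c.

(** The coordinates are nonnegative, so that some of them vanish together where
    their sum does. *)
Lemma cone_face (T : {set I}) :
  [set u | [forall (i | i \in N :\: T), lin (c i) (f u - f v) == 0]]%SET \in vfaces f.
Proof.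
have [_ c_ge0 _] := cone.
apply/vfacesP; exists (- \sum_(i in N :\: T) c i).
exists (- \sum_(i in N :\: T) lin (c i) (f v)).
have linE u : lin (- \sum_(i in N :\: T) c i) (f u) =
    - \sum_(i in N :\: T) lin (c i) (f v) - \sum_(i in N :\: T) lin (c i) (f u - f v).
  by rewrite linNc lin_sumc -opprD -big_split; congr (- _); apply: eq_bigr => i _;
    rewrite linB [RHS]addrC subrK.
have ge0 u i : i \in N :\: T -> 0 <= lin (c i) (f u - f v).
  by rewrite inE => /andP[_ iN]; apply: c_ge0.
split=> [u|].
  by rewrite linE gerBl sumr_ge0 // => i; apply: ge0.
apply/setP => u; rewrite !inE linE -subr_eq0 addrAC subrr add0r oppr_eq0.
apply/forall_inP/eqP => [H|]; first by rewrite big1 // => i /H/eqP.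
by move=> /(psumr_eq0P (ge0 u)) H i iN; rewrite H.
Qed.

Lemma cone_lin (d : 'cV[R]_n) u :
  lin d (f u) = lin d (f v) + \sum_(i in N) lin (c i) (f u - f v) * lin d (r i).
Proof.
have [_ _ cE] := cone; apply/eqP; rewrite addrC -subr_eq -linB {1}cE lin_sum.
by apply/eqP; apply: eq_bigr => i _; rewrite linZ.
Qed.

End ConeFaces.

(** The cone over the vertex figure: every segment from [f v] to another vertex
    crosses the figure.  The vertices [y i] of the simplex are on a hyperplane
    that avoids [f v], so affine independence of the [y i] becomes linear
    independence of the [y i - f v]. *)
Lemma vertex_figure_cone n (V : finType) (P : set 'rV[R]_n) (f : V -> 'rV[R]_n) v :
  simple_polytope P -> spans P f -> exists k (r : 'I_k -> 'rV[R]_n) c,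
    simplicial_cone f v finset.setT r c /\ forall i, P (f v + r i).
Proof.
move=> [_ Psimple] Pf; have [e [b [ev eu]]] := strict_support Pf v.
(* Scaling makes the other vertices exceed [f v] by more than 1, so that the
   section at height 1 is a vertex figure. *)
have [M HM] := exists_scaling (fun u => b - lin e (f u)) (fun=> 1).
pose d := - (M *: e).
have dv : lin d (f v) = - (M * b) by rewrite linNc linZc ev.
have du u : u != v -> lin d (f v) + 1 < lin d (f u).
  move=> uv; rewrite dv linNc linZc.
  by have := HM u; rewrite subr_gt0 => /(_ (eu u uv)); rewrite mulrBr; lra.
pose F := P `&` [set x | lin d x = lin d (f v) + 1].
have [k [y [y_aff FE]]] : simplex F.
  apply: (Psimple (f v)); first by apply/(vertex_spans Pf); exists v.
  exists d, (lin d (f v) + 1); split=> //; first by rewrite ltrDl.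
  by move=> _ /(vertex_spans Pf)[u ->] uv; apply: du; apply/eqP => uv'; apply: uv; rewrite uv'.
have yF i : F (y i) by rewrite FE conv_hullE; apply: hull_gen; rewrite inE.
have dy i : lin d (y i) = lin d (f v) + 1 by case: (yF i).
pose r i := y i - f v.
have dr i : lin d (r i) = 1 by rewrite linB dy addrAC subrr add0r.
have [c cr] : exists c : 'I_k -> 'cV[R]_n, forall i j, lin (c i) (r j) = (i == j)%:R.
  apply: dual_functionals => a a0.
  have suma : \sum_i a i = 0.
    have := congr1 (lin d) a0; rewrite lin_sum lin0 => E; rewrite -[RHS]E.
    by apply: eq_bigr => i _; rewrite linZ dr mulr1.
  apply: y_aff => //; rewrite -[RHS]a0 /r.
  under [RHS]eq_bigr do rewrite scalerBr.
  by rewrite sumrB -scaler_suml suma scale0r subr0.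
have conic u : exists a : 'I_k -> R, (forall i, 0 <= a i) /\ f u - f v = \sum_i a i *: r i.
  have [->|uv] := eqVneq u v.
    by exists (fun=> 0); split=> //; rewrite subrr big1 // => i _; rewrite scale0r.
  have duv : 1 < lin d (f u - f v) by rewrite linB ltrBrDl du.
  have duv0 : 0 < lin d (f u - f v) by apply: lt_trans duv.
  set s := lin d (f u - f v) in duv duv0.
  have : F (f v + s^-1 *: (f u - f v)).
    split=> /=; last by rewrite linD linZ -/s mulVf // gt_eqF.
    rewrite Pf.1; apply: segment_hull; rewrite ?invr_ge0 ?(ltW duv0) //.
    - by apply: hull_gen; rewrite inE.
    - by apply: hull_gen; rewrite inE.
    - by rewrite invf_le1 // ltW.
  rewrite FE => -[a [a0 a1 E]]; exists (fun i => s * a i); split=> [i|].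
    by rewrite mulr_ge0 // ltW.
  under eq_bigr do rewrite -scalerA.
  rewrite -scaler_sumr; have -> : \sum_i a i *: r i = s^-1 *: (f u - f v).
    under eq_bigr do rewrite scalerBr.
    by rewrite sumrB -scaler_suml a1 scale1r -E addrAC subrr add0r.
  by rewrite scalerA divff ?scale1r // gt_eqF.
have coordE u : exists a : 'I_k -> R, [/\ forall i, 0 <= a i,
     f u - f v = \sum_i a i *: r i & forall i, lin (c i) (f u - f v) = a i].
  have [a [a0 aE]] := conic u; exists a; split=> // i; rewrite aE lin_sum.
  rewrite (bigD1 i) //= big1 ?addr0 => [|j ji]; rewrite linZ cr ?eqxx ?mulr1 //.
  by rewrite eq_sym (negbTE ji) mulr0.
exists k, r, c; split; last by move=> i; rewrite addrC subrK; case: (yF i).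
split=> [i j _ _|i u _|u]; first exact: cr.
- by have [a [a0 _ ->]] := coordE u.
- have [a [_ aE ca]] := coordE u; rewrite {1}aE.
  by apply: eq_big => [i|i _]; rewrite ?finset.in_setT ?ca.
Qed.

(** The generators of the cone are here the edge directions themselves. *)
Definition simple_at n (V : finType) (f : V -> 'rV[R]_n) v (N : {set V}) : Prop :=
  exists c, simplicial_cone f v N (fun w => f w - f v) c.

(** Each ray of the cone of [vertex_figure_cone] carries an edge: the face on
    that ray contains a second vertex, and no third one as vertices on a line
    are at most two.  Conversely the functional of an edge vanishes on some
    ray, so that the edge is the one on this ray.  Rescaling the rays to reach
    the neighbours gives the claim. *)
Lemma simple_at_vnbrs n (V : finType) (P : set 'rV[R]_n) (f : V -> 'rV[R]_n) v :
  simple_polytope P -> spans P f -> simple_at f v (vnbrs f v).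
Proof.
move=> Psimple Pf; have [k [r [c [cone rP]]]] := vertex_figure_cone v Psimple Pf.
have [cr0 c_ge00 cE0] := cone.
have cr i j : lin (c i) (r j) = (i == j)%:R by apply: cr0; rewrite inE.
pose co i u := lin (c i) (f u - f v).
have co_ge0 i u : 0 <= co i u by apply: c_ge00; rewrite inE.
have coE u : f u - f v = \sum_i co i u *: r i.
  by rewrite [LHS]cE0; apply: eq_bigl => i; rewrite finset.in_setT.
have co_v i : co i v = 0 by rewrite /co subrr lin0.
have on_ray i u : (forall j, j != i -> co j u = 0) -> f u - f v = co i u *: r i.
  by move=> u0; rewrite coE (bigD1 i) //= big1 ?addr0 // => j /u0 ->; rewrite scale0r.
have edge i : exists u, [/\ u \in vnbrs f v, forall j, j != i -> co j u = 0 & 0 < co i u].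
  have [a [a0 a1 rE]] : hull f finset.setT (f v + r i) by rewrite -Pf.1.
  have coefE j : \sum_(u in finset.setT) a u * co j u = (j == i)%:R.
    rewrite -cr -[r i](addKr (f v)) rE addrC linB lin_sum -[X in _ - X]mul1r -a1.
    by rewrite mulr_suml -sumrB; apply: eq_bigr => u _; rewrite linZ -mulrBr -linB.
  (* A vertex with positive weight in [f v + r i] has all coordinates 0 except
     the one along [r i]. *)
  have [u ua] : exists u, a u * co i u != 0.
    apply: contrapT => /forallNP H; have /eqP := coefE i.
    by rewrite big1 ?eqxx ?(eq_sym 0) ?oner_eq0 // => u _; apply/eqP/negP => /negP/H.
  move: ua; rewrite mulf_eq0 negb_or => /andP[au0 cu0].
  have cou : 0 < co i u by rewrite lt_def cu0 co_ge0.
  have co0 j : j != i -> co j u = 0.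
    move=> ji; have := coefE j; rewrite (negbTE ji) => /psumr_eq0P H.
    have /eqP := H (fun w _ => mulr_ge0 (a0 w) (co_ge0 j w)) u (finset.in_setT u).
    by rewrite mulf_eq0 (negbTE au0) => /eqP.
  exists u; split=> //.
  have vu : v != u by apply: contraTneq cou => <-; rewrite co_v ltxx.
  rewrite inE vu; have := cone_face cone [set i]%SET.
  set K := finset _ => Kf.
  have KP w : reflect (forall j, j != i -> co j w = 0) (w \in K).
    rewrite inE; apply: (iffP forall_inP) => H j.
      by move=> ji; apply/eqP/H; rewrite !inE ji.
    by rewrite !inE andbT => /H/eqP.
  suff <- : K = [set v; u]%SET by [].
  apply/eqP; rewrite finset.eqEsubset; apply/andP; split; last first.
    by rewrite finset.subUset !finset.sub1set; apply/andP; split; apply/KP.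
  apply/fintype.subsetP => w /KP wK; rewrite !inE; apply: contraT.
  rewrite negb_or => /andP[wv wu]; exfalso.
  have [vw uw] : v != w /\ u != w by rewrite !(eq_sym _ w).
  have [||_ _ /eqP] := @aff_indep3 _ _ _ _ _ Pf v u w
      (co i w / co i u - 1) (- (co i w / co i u)) 1 vu vw uw; last by rewrite oner_eq0.
  - by ring.
  - have -> : f w = f v + (co i w / co i u) *: (f u - f v).
      by rewrite (on_ray i u co0) scalerA divfK // -(on_ray i w wK) addrC subrK.
    by apply/rowP => j; rewrite !mxE; ring.
have [w_ wP] := choice edge.
have w_nb i : w_ i \in vnbrs f v by case: (wP i).
have w_on u : u \in vnbrs f v -> exists i, w_ i = u.
  rewrite inE => /andP[vu /vfacesP[d [b [db E]]]].
  have dE x : (x == v) || (x == u) = (lin d (f x) == b).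
    by rewrite -(finset.in_set2 x v u) E inE.
  have dv : lin d (f v) = b by apply/eqP; rewrite -dE eqxx.
  have du : lin d (f u) = b by apply/eqP; rewrite -dE eqxx orbT.
  have dr i : lin d (r i) <= 0.
    have := rP i; rewrite Pf.1 => /(lin_hull_le (c := d) (b := b)).
    by rewrite linD dv gerDl; apply.
  have sum0 : \sum_(i in finset.setT) - (co i u * lin d (r i)) = 0.
    by rewrite sumrN; have := cone_lin cone d u; rewrite du dv; lra.
  have term0 i : co i u * lin d (r i) = 0.
    apply/eqP; rewrite -oppr_eq0; apply/eqP; apply: (psumr_eq0P _ sum0); rewrite ?inE //.
    by move=> j _; rewrite oppr_ge0 mulr_ge0_le0.
  have [i ci] : exists i, co i u != 0.
    apply: contrapT => /forallNP H; move: vu; rewrite eq_sym -(inj_eq (spans_inj Pf)).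
    rewrite -subr_eq0 coE big1 ?eqxx // => i _.
    by have /negP := H i; rewrite negbK => /eqP ->; rewrite scale0r.
  exists i; have [wi_nb wi0 wi_gt0] := wP i.
  have di : lin d (r i) = 0 by have /eqP := term0 i; rewrite mulf_eq0 (negbTE ci) => /eqP.
  have : (w_ i == v) || (w_ i == u).
    rewrite dE -(subrK (f v) (f (w_ i))) linD (on_ray i) // linZ di mulr0 add0r.
    by rewrite dv.
  by case/orP => /eqP // wv; move: wi_gt0; rewrite wv co_v ltxx.
pose s i := co i (w_ i).
have s_gt0 i : 0 < s i by case: (wP i).
have edgeE i : f (w_ i) - f v = s i *: r i by apply: on_ray; case: (wP i).
have /choice[c' c'P] : forall u, exists c' : 'cV[R]_n, u \in vnbrs f v ->
    (forall w, w \in vnbrs f v -> lin c' (f w - f v) = (u == w)%:R) /\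
    (forall x, 0 <= lin c' (f x - f v)).
  move=> u; have [/w_on[i <-]|] := boolP (u \in vnbrs f v); last by exists 0.
  exists ((s i)^-1 *: c i) => _; split=> [w /w_on[j <-]|x]; last first.
    by rewrite linZc mulr_ge0 ?invr_ge0 ?(ltW (s_gt0 i)) ?co_ge0.
  rewrite linZc edgeE linZ cr; have [->|ij] := eqVneq i j.
    by rewrite !eqxx mulr1 mulVf // gt_eqF.
  rewrite !mulr0; case: eqP => // wij; exfalso.
  have [_ wj0 _] := wP j; have := s_gt0 i.
  by rewrite /s wij wj0 // ltxx.
exists c'; split=> [u w uN|u x uN|x].
- by have [H _] := c'P u uN; apply: H.
- by have [_ H] := c'P u uN; apply: H.
(* The coordinates are regrouped by the neighbour that each ray reaches. *)
pose b w := \sum_(i | w_ i == w) co i x / s i.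
have xE : f x - f v = \sum_(w in vnbrs f v) b w *: (f w - f v).
  rewrite coE (partition_big w_ (mem (vnbrs f v))) /= => [|i _]; last exact: w_nb.
  apply: eq_bigr => w _; rewrite scaler_suml; apply: eq_bigr => i /eqP <-.
  by rewrite edgeE scalerA divfK // gt_eqF.
rewrite [LHS]xE; apply: eq_bigr => w wN; congr (_ *: _).
have [H _] := c'P w wN; rewrite xE lin_sum (bigD1 w) //= big1 => [|u /andP[uN uw]].
  by rewrite linZ H // eqxx mulr1 addr0.
by rewrite linZ H // eq_sym (negbTE uw) mulr0.
Qed.

End SimpleVertices.

(** * The face system of a simple polytope *)
Section SimpleFaces.
Context {R : realType}.

(** The functional of a face through [v] is nonincreasing along each edge at [v];
    so a point stays on the face only by moving along edges of the face. *)
Lemma cone_support n (V : finType) (f : V -> 'rV[R]_n) v N c A u i :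
  simplicial_cone f v N (fun w => f w - f v) c -> A \in vfaces f ->
  v \in A -> u \in A -> i \in N -> lin (c i) (f u - f v) != 0 -> i \in A.
Proof.
move=> cone /vfacesP[d [b [db AE]]]; have [_ c_ge0 _] := cone.
rewrite AE !inE => /eqP dv /eqP du iN ci.
have sum0 : \sum_(j in N) lin (c j) (f u - f v) * (b - lin d (f j)) = 0.
  have := cone_lin cone d u; rewrite du dv => E.
  transitivity (- \sum_(j in N) lin (c j) (f u - f v) * lin d (f j - f v)).
    2: by lra.
  by rewrite -sumrN; apply: eq_bigr => j _; rewrite [lin d (_ - _)]linB dv -mulrN opprB.
have ge0 j : j \in N -> 0 <= lin (c j) (f u - f v) * (b - lin d (f j)).
  by move=> jN; rewrite mulr_ge0 ?c_ge0 // subr_ge0.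
have /eqP := psumr_eq0P ge0 sum0 iN.
by rewrite mulf_eq0 (negbTE ci) subr_eq0 eq_sym.
Qed.

(** On the moment curve, a functional takes equal values at two given points
    only for finitely many parameters, the roots of a nonzero polynomial. *)
Lemma exists_injective_functional n (V : finType) (f : V -> 'rV[R]_n) :
  injective f -> exists g : 'cV[R]_n, injective (fun v => lin g (f v)).
Proof.
move=> f_inj; pose q (p : V * V) := rVpoly (f p.1 - f p.2).
pose Q := \prod_(p | p.1 != p.2) q p.
have Q0 : Q != 0.
  apply/prodf_neq0 => p; apply: contraNneq => q0.
  have : f p.1 - f p.2 = 0 by rewrite -[LHS]rVpolyK -/(q p) q0 linear0.
  by move/eqP; rewrite subr_eq0 (inj_eq f_inj).
have [t Qt] : exists t : R, ~~ root Q t.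
  apply: contrapT => /forallNP H.
  have := ltnn (size Q); rewrite -{1}(size_iota 0 (size Q)).
  rewrite -(size_map (fun i => i%:R : R)) max_poly_roots //.
    by apply/allP => x _; have /negP := H x; rewrite negbK.
  by rewrite map_inj_uniq ?iota_uniq // => i j /eqP; rewrite eqr_nat => /eqP.
pose g : 'cV[R]_n := \col_i t ^+ i.
have gE x : lin g x = (rVpoly x).[t].
  rewrite /rVpoly horner_poly /lin mxE; apply: eq_bigr => i _.
  by rewrite valK mxE.
exists g => u v /= guv; apply/eqP; apply: contraNT Qt => uv.
by rewrite /root /Q horner_prod (bigD1 (u, v)) //= /q -gE linB guv subrr mul0r.
Qed.

Section FaceSystemOfCones.
Context {n : nat} {V : finType} (f : V -> 'rV[R]_n) (P : set 'rV[R]_n) (e : rel V).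
Hypothesis Pf : spans P f.
Hypothesis f_simple : forall v, simple_at f v (nbrs e v).
Implicit Types (T F : {set V}).

Lemma vfaces_span v T : T \subset nbrs e v ->
  exists F, [/\ F \in vfaces f, v \in F & F :&: nbrs e v = T]%SET.
Proof.
move=> TN; have [c cone] := f_simple v; have [cr _ _] := cone.
exists [set u | [forall (i | i \in nbrs e v :\: T), lin (c i) (f u - f v) == 0]]%SET; split.
- exact: cone_face cone T.
- by rewrite inE; apply/forall_inP => i _; rewrite subrr lin0.
apply/setP => w; rewrite finset.in_setI; have [wN|wN] := boolP (w \in nbrs e v); last first.
  by rewrite andbF; apply/esym/negP => /(fintype.subsetP TN); apply/negP.
rewrite andbT inE; apply/forall_inP/idP => [H|wT i].
  apply: contraT => wT; have := H w; rewrite finset.in_setD wT wN => /(_ isT).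
  by rewrite cr // eqxx oner_eq0.
rewrite finset.in_setD => /andP[iT iN]; rewrite cr //.
by have [iw|_] := eqVneq i w; [rewrite iw wT in iT|rewrite eqxx].
Qed.

Lemma vfaces_sub v F F' : F \in vfaces f -> F' \in vfaces f ->
  v \in F -> v \in F' -> F :&: nbrs e v \subset F' -> F \subset F'.
Proof.
move=> Ff /vfacesP[d [b [_ ->]]] vF; rewrite inE => /eqP dv FN.
apply/fintype.subsetP => u uF; have [c cone] := f_simple v.
rewrite inE (cone_lin cone d u) dv big1 ?addr0 // => i iN.
have [->|ci] := eqVneq (lin (c i) (f u - f v)) 0; first by rewrite mul0r.
have iF := cone_support cone Ff vF uF iN ci.
have : i \in (F :&: nbrs e v)%SET by rewrite finset.in_setI iF.
by move/(fintype.subsetP FN); rewrite inE [lin d (_ - _)]linB dv => /eqP ->; rewrite subrr mulr0.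
Qed.

(** At a sink [v] of [F], the functional decreases along all edges of [F] at [v],
    and these generate a cone that contains [F]. *)
Lemma linear_good (g : 'cV[R]_n) : injective (fun v => lin g (f v)) ->
  good e (vfaces f) (fun v => lin g (f v)).
Proof.
move=> g_inj; split=> // F v w FF /andP[vF /forall_inP vmax] wF.
have [c cone] := f_simple v; have [_ c_ge0 _] := cone.
rewrite (cone_lin cone g w) gerDl; apply: sumr_le0 => i iN.
have [->|ci] := eqVneq (lin (c i) (f w - f v)) 0; first by rewrite mul0r.
have iF := cone_support cone FF vF wF iN ci.
rewrite mulr_ge0_le0 ?c_ge0 // linB subr_le0 ltW //.
by move: iN; rewrite inE => evi; apply: (implyP (vmax i iF)).
Qed.

(** The functional [M *: c + g] orders the vertices first by the functional [c]
    of the face, and then by a generic [g]. *)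
Lemma face_first F : F \in vfaces f -> exists phi : V -> R,
  good e (vfaces f) phi /\ forall u w, u \in F -> w \notin F -> phi u < phi w.
Proof.
move=> /vfacesP[c [b [cb FE]]].
have [g g_inj] := exists_injective_functional (spans_inj Pf).
have [M HM] := exists_scaling (fun p : V * V => lin c (f p.1) - lin c (f p.2))
  (fun p => lin g (f p.2) - lin g (f p.1)).
pose h := - (M *: c + g).
have hE u : lin h (f u) = - (M * lin c (f u) + lin g (f u)).
  by rewrite linNc linDc linZc.
have h_lt u w : lin c (f w) < lin c (f u) -> lin h (f u) < lin h (f w).
  move=> cwu; have := HM (u, w); rewrite subr_gt0 => /(_ cwu) /=.
  by rewrite mulrBr !hE; lra.
exists (fun v => lin h (f v)); split.
  apply: linear_good => u w /= huw.
  have [cuw|cuw|cuw] := ltgtP (lin c (f u)) (lin c (f w)).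
  - by have := h_lt _ _ cuw; rewrite huw ltxx.
  - by have := h_lt _ _ cuw; rewrite huw ltxx.
  - by apply: g_inj; move: huw; rewrite /= !hE cuw; lra.
move=> u w; rewrite FE !inE => /eqP cu cw; apply: h_lt.
by rewrite cu lt_neqAle cw cb.
Qed.

Lemma vfaces_system : face_system R e (vfaces f).
Proof.
split.
- exact: setT_vfaces.
- exact: vfaces_cap.
- exact: vfaces_span.
- exact: vfaces_sub.
- exact: face_first.
Qed.

End FaceSystemOfCones.

(** The coordinates of a point of a face vanish along the edges that leave the
    face, by [cone_support]. *)
Lemma simple_at_restrict n (V W : finType) (f : V -> 'rV[R]_n) (i : W -> V) w N :
  injective i -> (i @: [set: W] \in vfaces f)%SET -> simple_at f (i w) N ->
  simple_at (f \o i) w [set x | i x \in N]%SET.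
Proof.
move=> i_inj Wf [c cone]; have [cr c_ge0 cE] := cone.
exists (c \o i); split=> [x y|x y|y].
- by rewrite !inE => xN yN; rewrite /= cr // (inj_eq i_inj).
- by rewrite inE /=; apply: c_ge0.
rewrite /= [LHS]cE (big_setID (i @: [set: W])%SET) /= [X in _ + X]big1 ?addr0.
  have -> : (N :&: i @: [set: W] = i @: [set x | i x \in N])%SET.
    apply/setP => v; rewrite finset.in_setI; apply/andP/finset.imsetP.
      by move=> [vN /finset.imsetP[x _ vx]]; exists x; rewrite // inE -vx.
    by move=> [x]; rewrite inE => xN ->; rewrite xN finset.imset_f // inE.
  by rewrite big_imset //= => x x' _ _; apply: i_inj.
move=> v; rewrite finset.in_setD => /andP[vW vN].
have [->|cv] := eqVneq (lin (c v) (f (i y) - f (i w))) 0; first by rewrite scale0r.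
by move: vW; rewrite (cone_support cone Wf _ _ vN cv) // finset.imset_f // inE.
Qed.

(** The generators [f w - f v] are edges whose ends lie beyond the cutting
    hyperplane; they cross it in points [z w], and the section is the simplex on
    these points, as its coordinates in the cone show. *)
Lemma simple_of_simple_at n (V : finType) (P : set 'rV[R]_n) (f : V -> 'rV[R]_n) :
  spans P f -> (forall v, exists N, simple_at f v N) -> simple_polytope P.
Proof.
move=> Pf f_simple; split; first exact: spans_polytope Pf.
move=> _ S /(vertex_spans Pf)[v ->] [d [b [dv dw ->]]].
have [N [c cone]] := f_simple v; have [cr c_ge0 cE] := cone.
have vN : v \notin N.
  apply/negP => vN; have := cr v v vN vN; rewrite subrr lin0 eqxx => /eqP.
  by rewrite eq_sym oner_eq0.
pose s w := lin d (f w - f v).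
have s_gt w : w \in N -> b - lin d (f v) < s w.
  move=> wN; rewrite /s linB ltrD2r; apply: dw; first by apply/(vertex_spans Pf); exists w.
  by move/(spans_inj Pf) => wv; move: vN; rewrite -wv wN.
have b_gt0 : 0 < b - lin d (f v) by rewrite subr_gt0.
set h := b - lin d (f v) in s_gt b_gt0.
have s_gt0 w : w \in N -> 0 < s w by move=> /s_gt; apply: lt_trans.
pose z w := f v + (h / s w) *: (f w - f v).
exists #|N|, (fun i => z (enum_val i)); split.
  move=> a a0 az i.
  have comb0 : \sum_j (a j * (h / s (enum_val j))) *: (f (enum_val j) - f v) = 0.
    move: az; under eq_bigr do rewrite scalerDr scalerA.
    by rewrite big_split /= -scaler_suml a0 scale0r add0r.
  have := congr1 (lin (c (enum_val i))) comb0; rewrite lin_sum lin0 (bigD1 i) //=.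
  rewrite big1 ?addr0 => [|j ji]; last first.
    by rewrite linZ cr ?enum_valP // (inj_eq enum_val_inj) eq_sym (negbTE ji) mulr0.
  rewrite linZ cr ?enum_valP // eqxx mulr1 => /eqP; rewrite mulf_eq0 => /orP[/eqP//|].
  by rewrite mulf_eq0 invr_eq0 !gt_eqF ?s_gt0 ?enum_valP.
have zE w : w \in N -> P (z w) /\ lin d (z w) = b.
  move=> wN; split; last first.
    by rewrite /z linD linZ -/(s w) divfK ?gt_eqF ?s_gt0 // addrC subrK.
  rewrite Pf.1; apply: segment_hull; try by apply: hull_gen; rewrite inE.
    by rewrite divr_ge0 // ltW ?s_gt0.
  by rewrite ler_pdivrMr ?s_gt0 // mul1r ltW // s_gt.
rewrite -hull_enum; apply/seteqP; split=> [p [Pp /= dp]|p zp].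
  have [a [a_ge0 aE]] : exists a : V -> R, (forall w, w \in N -> 0 <= a w) /\
      p = f v + \sum_(w in N) a w *: (f w - f v).
    move: Pp; rewrite Pf.1 => -[t [t0 t1 ->]].
    exists (fun w => \sum_(u in finset.setT) t u * lin (c w) (f u - f v)); split.
      by move=> w wN; apply: sumr_ge0 => u _; rewrite mulr_ge0 ?c_ge0.
    under [X in _ = _ + X]eq_bigr do rewrite scaler_suml.
    rewrite exchange_big /= -[X in _ = X + _]scale1r -t1 scaler_suml -big_split.
    apply: eq_bigr => u _ /=; under eq_bigr do rewrite -scalerA.
    by rewrite -scaler_sumr -cE -scalerDr addrC subrK.
  have sum_h : \sum_(w in N) a w * s w = h.
    rewrite /h -dp aE linD lin_sum [RHS]addrAC subrr add0r.
    by apply: eq_bigr => w _; rewrite linZ.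
  pose a' w := if w \in N then a w * s w / h else 0.
  have a'1 : \sum_(w in N) a' w = 1.
    transitivity ((\sum_(w in N) a w * s w) / h); last by rewrite sum_h divff // gt_eqF.
    by rewrite mulr_suml; apply: eq_bigr => w; rewrite /a' => ->.
  exists a'; split=> // [w|].
    rewrite /a'; case: ifP => // wN.
    by rewrite divr_ge0 ?mulr_ge0 ?a_ge0 ?ltW ?s_gt0.
  under eq_bigr do rewrite scalerDr scalerA.
  rewrite big_split /= -scaler_suml a'1 scale1r aE; congr (_ + _).
  apply: eq_bigr => w wN; congr (_ *: _); rewrite /a' wN.
  by field; rewrite !gt_eqF ?s_gt0.
have zN w : w \in N -> hull z N (z w) by move=> wN; apply: hull_gen.
split=> /=.
  by rewrite Pf.1; move: p zp; apply: hull_hull => w /zE[]; rewrite Pf.1.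
have [a [a0 a1 ->]] := zp; rewrite lin_sum -[RHS]mul1r -a1 mulr_suml.
by apply: eq_bigr => w /zE[_ zw]; rewrite linZ zw.
Qed.

End SimpleFaces.

(** * Simple polytopes with a product graph *)
Section SimplePolytopeGraphs.
Context {R : realType}.

Lemma simple_graph n (V : finType) (e : rel V) (P : set 'rV[R]_n)
    (f : V -> 'rV[R]_n) :
  simple_polytope P -> set_bij setT (vertex P) f ->
  (forall u w, e u w <-> polytope_adj P (f u) (f w)) ->
  [/\ spans P f, forall v, nbrs e v = vnbrs f v,
      forall v, simple_at f v (nbrs e v) & face_system R e (vfaces f)].
Proof.
move=> Psimple fbij eE; have Pf := polytope_spans Psimple.1 fbij.
have nE v : nbrs e v = vnbrs f v.
  apply/setP => w; rewrite [LHS]inE [RHS]inE; apply/idP/andP => [/eE|].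
    by move/(polytope_adj_spans Pf).
  by move/(polytope_adj_spans Pf)/eE.
have sv v : simple_at f v (nbrs e v) by rewrite nE; apply: simple_at_vnbrs Psimple Pf.
by split=> //; apply: vfaces_system Pf sv.
Qed.

Lemma simple_face_graph n (V : finType) (e : rel V) (P : set 'rV[R]_n)
    (f : V -> 'rV[R]_n) (K : sgraph) (i : K -> V) :
  spans P f -> (forall v, nbrs e v = vnbrs f v) ->
  (forall v, simple_at f v (nbrs e v)) ->
  injective i -> (forall x y, e (i x) (i y) = adj x y) ->
  (i @: [set: K])%SET \in vfaces f ->
  let Q := hull (f \o i) finset.setT in
  [/\ spans Q (f \o i), simple_polytope Q & has_graph Q K].
Proof.
move=> Pf nE f_simple i_inj i_adj iK Q.
have Qf : spans Q (f \o i).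
  by split=> // x; rewrite (vfaces_restrict _ i_inj iK) finset.imset_set1 Pf.2.
split=> //.
  apply: simple_of_simple_at Qf _ => x; eexists.
  exact: simple_at_restrict i_inj iK (f_simple (i x)).
exists (f \o i); split=> [|x y]; first exact: spans_bij Qf.
have adjE : adj x y = (i y \in vnbrs f (i x)) by rewrite -nE inE i_adj.
rewrite (polytope_adj_spans Qf) (vfaces_restrict _ i_inj iK) finset.imsetU1.
rewrite finset.imset_set1 adjE inE (inj_eq i_inj).
by split=> [/andP|] => [//|[-> ->]].
Qed.

(** The two factors are the faces on the fibers through an arbitrary vertex
    [(g0, h0)]. *)
Lemma simple_product n (G H : sgraph) (P : set 'rV[R]_n) (f : G * H -> 'rV[R]_n) :
  simple_polytope P -> set_bij setT (vertex P) f ->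
  (forall u w, cart_adj u w <-> polytope_adj P (f u) (f w)) ->
  exists (Q S : set 'rV[R]_n),
    [/\ simple_polytope Q, has_graph Q G, simple_polytope S, has_graph S H
      & comb_equiv P (polytope_prod Q S)].
Proof.
move=> Ps fbij fadj; have e_sym := @cart_adj_sym G H; have e_irr := @cart_adj_irr G H.
have [Pf nE f_simple FS] := simple_graph Ps fbij fadj.
have /card_gt0P[g0 _] := vert_gt0 G; have /card_gt0P[h0 _] := vert_gt0 H.
have GHprod := cart_is_product G H.
pose iG (g : G) : G * H := (g, h0); pose iH (h : H) : G * H := (g0, h).
have iG_inj : injective iG by move=> g g' [].
have iH_inj : injective iH by move=> h h' [].
have iGE (S : {set G}) : (iG @: S)%SET = [set x : G * H | (x.1 \in S) && (x.2 == h0)]%SET.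
  apply/setP => -[g h]; rewrite inE /=; apply/finset.imsetP/andP.
    by move=> [g' g'S [-> ->]].
  by move=> [gS /eqP ->]; exists g.
have iHE (T : {set H}) : (iH @: T)%SET = [set x : G * H | (x.1 == g0) && (x.2 \in T)]%SET.
  apply/setP => -[g h]; rewrite inE /=; apply/finset.imsetP/andP.
    by move=> [h' h'T [-> ->]].
  by move=> [/eqP -> hT]; exists h.
have iG_face : (iG @: [set: G])%SET \in vfaces f.
  rewrite (_ : iG @: _ = [set x : G * H | x.2 == (g0, h0).2])%SET.
    exact: (fiber_face e_sym e_irr FS GHprod (g0, h0)).
  by rewrite iGE; apply/setP => x; rewrite !inE.
have iH_face : (iH @: [set: H])%SET \in vfaces f.
  rewrite (_ : iH @: _ = [set x : G * H | x.1 == (g0, h0).1])%SET.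
    exact: (fiber_face e_sym e_irr FS (is_product_sym GHprod) (g0, h0)).
  by rewrite iHE; apply/setP => x; rewrite !inE andbT.
have iG_adj g g' : cart_adj (iG g) (iG g') = adj g g'.
  by rewrite /= /cart_adj /= eqxx adj_irr andbF.
have iH_adj h h' : cart_adj (iH h) (iH h') = adj h h'.
  by rewrite /= /cart_adj /= eqxx adj_irr andbF orbF.
have [Qf Qs Qg] := simple_face_graph Pf nE f_simple iG_inj iG_adj iG_face.
have [Sf Ss Sg] := simple_face_graph Pf nE f_simple iH_inj iH_adj iH_face.
do 2!eexists; split; [exact: Qs|exact: Qg|exact: Ss|exact: Sg|].
apply: comb_equiv_vfaces Pf (spans_prod Qf Sf) _.
apply/setP => A; have [->|A0] := eqVneq A finset.set0; first by rewrite !set0_vfaces.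
have prodP := product_faceP e_sym e_irr FS GHprod g0 h0 A0.
have ptsP := vfaces_prod (f \o iG) (f \o iH) A0.
apply/idP/idP => [/prodP|/ptsP] [S [T [S0 T0 SF TF AE]]].
  apply/ptsP; exists S, T; split=> //.
    by rewrite (vfaces_restrict _ iG_inj iG_face) iGE.
  by rewrite (vfaces_restrict _ iH_inj iH_face) iHE.
apply/prodP; exists S, T; split=> //.
  by rewrite -iGE -(vfaces_restrict _ iG_inj iG_face).
by rewrite -iHE -(vfaces_restrict _ iH_inj iH_face).
Qed.

End SimplePolytopeGraphs.

Theorem corollary2p4 (R : realType) (G H : sgraph)
    (GH_poly : simply_polytopal R (cart G H)) :
  (forall (n n' : nat) (P : set 'rV[R]_n) (P' : set 'rV[R]_n'),
      simple_polytope P -> has_graph P (cart G H) ->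
      simple_polytope P' -> has_graph P' (cart G H) ->
      comb_equiv P P') /\
  (forall (n : nat) (P : set 'rV[R]_n),
      simple_polytope P -> has_graph P (cart G H) ->
      exists (m k : nat) (Q : set 'rV[R]_m) (S : set 'rV[R]_k),
        [/\ simple_polytope Q, has_graph Q G,
            simple_polytope S, has_graph S H
          & comb_equiv P (polytope_prod Q S)]).
Proof.
have e_sym := @cart_adj_sym G H; have e_irr := @cart_adj_irr G H.
split=> [n n' P P' Ps [f [fbij fadj]] P's [f' [f'bij f'adj]]|n P Ps [f [fbij fadj]]].
  have [Pf _ _ FS] := @simple_graph _ _ (G * H)%type (@cart_adj G H) _ _ Ps fbij fadj.
  have [Pf' _ _ FS'] :=
    @simple_graph _ _ (G * H)%type (@cart_adj G H) _ _ P's f'bij f'adj.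
  apply: comb_equiv_vfaces Pf Pf' _.
  by apply: (face_system_unique e_sym e_irr _ _ FS FS'); apply: set0_vfaces.
have [Q [S PQS]] := @simple_product _ _ G H _ f Ps fbij fadj.
by exists n, n, Q, S.
Qed.
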